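(* Let $\Omega=(0,1)$, $L_c=0$, $\mu>0$, $\mu_c\ge 0$ and $\gamma>0$. Any solution $u\in X:=\{u\in W^{2,2}(\Omega)\mid u(0)=0,\ u(1)=\gamma\}$ of the minimization problem $E(u,\alpha)\to\min$ is monotonically increasing. The homogeneous function $\overline{u}(x):=\gamma x$ solves the Euler-Lagrange equations $$[2\mu+(\mu_c-\mu)\cos^2(\alpha)]\,u''=2(\mu_c-\mu)\big(\sin(\alpha)\cos(\alpha)u'+\cos^2(\alpha)-\sin^2(\alpha)\big)\alpha'+2\mu\cos(\alpha)\alpha',$$ $$0=\big(\cos(\alpha)u'-2\sin(\alpha)\big)\Big[(\mu-\mu_c)\Big(\sin(\alpha)u'-4\sin^2\big(\tfrac{\alpha}{2}\big)\Big)-2\mu_c\Big]$$ in $\Omega$. Depending on the values of $\mu$ and $\mu_c$, the corresponding solution $\alpha$ of these equations is given by: (i) If $\mu=\mu_c$: $\alpha(x)\equiv\alpha_2$. Moreover $(\overline{u},\alpha_2)$ is a local minimizer of $E$. (ii) If $\mu_c=0$: $\alpha(x)\equiv\alpha_1^-=0$, $\alpha(x)\equiv\alpha_2$, $\alpha(x)\equiv\alpha_3$. Moreover $(\overline{u},0)$ and $(\overline{u},\alpha_3)$ are local minimizers of $E$. (iii) If $\mu_c>0$ and $\mu\neq\mu_c$: $\alpha(x)\equiv\alpha_2$, and $\alpha(x)\equiv\alpha_1^{\pm}$ whenever $\alpha_1^\pm$ exist. Moreover, for $\mu_c>\mu_c^{\mathrm{crit}}$, $(\overline{u},\alpha_2)$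 is a local minimizer of $E$; and $(\overline{u},\alpha_1^\pm)$ are local minimizers of $E$ if $\mu>\mu_c$, $\mu_c\le\mu_c^{\mathrm{crit}}$ and $\alpha_1^\pm\neq\alpha_2$.
   Context: For $L_c=0$ the mechanical energy functional is $$E(u,\alpha)=\frac{\mu}{2}\int_0^1|u'|^2+\Big(\sin(\alpha)u'-4\sin^2\big(\tfrac{\alpha}{2}\big)\Big)^2dx+\frac{\mu_c}{2}\int_0^1\Big(\cos(\alpha)u'-2\sin(\alpha)\Big)^2dx$$ for real-valued $u,\alpha$ on $\Omega=(0,1)$. The minimization problem $E(u,\alpha)\to\min$ is considered subject either to the consistent coupling conditions $u(0)=0$, $u(1)=\gamma$, $u'(0)=2\tan(\alpha(0))$, $u'(1)=2\tan(\alpha(1))$, or to the Dirichlet conditions $u(0)=0$, $u(1)=\gamma$, $\alpha(0)=\alpha(1)=\alpha_D$ for a prescribed $\alpha_D\in\mathbb{R}$. The statements about $\alpha$ concern solutions of the Euler-Lagrange equations in $\Omega$, with the boundary conditions on $\alpha$ ignored; solutions are considered in the regularity class $u\in W^{2,2}(\Omega)$, $\alpha\in W^{1,2}(\Omega)$. Let $\eta(\alpha):=\dfrac{4\sin^2(\alpha/2)}{\sin(\alpha)}$, extended by $\eta(0)=0$; it is monotone increasing and invertible. The constants are $$f:=\sqrt{(\gamma^2+4)(\mu-\mu_c)^2-4\mu^2},$$ $$\alpha_1^-:=\arctan\Big(\frac{\gamma\mu-f}{2\mu+\frac{\gamma}{2}f}\Big),\quad \alpha_1^+:=\arctan\Big(\frac{\gamma\mu+f}{2\mu-\frac{\gamma}{2}f}\Big),\quad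 \alpha_2:=\arctan\Big(\frac{\gamma}{2}\Big),\quad \alpha_3:=\eta^{-1}(\gamma),$$ $$\mu_c^{\mathrm{crit}}:=\mu\Big[1-\frac{2}{\sqrt{\gamma^2+4}}\Big].$$ The constants $\alpha_1^\pm$ exist (are well-defined) when $4\mu\neq\gamma f$ and either $\mu>\mu_c$ and $\mu_c\le\mu_c^{\mathrm{crit}}$, or $\mu_c\ge\mu\big(1+\frac{2}{\sqrt{\gamma^2+4}}\big)$.
   Formalization: In α₁^± the arctan is shifted by π when μ−μ_c and the denominator have opposite signs (the principal value then fails to solve the equations); the list of solutions α is complete up to periods π (α₂) and 2π (α₁^±, α₃), and in (iii) completeness is claimed only for 4μ≠γf. *)

(* Defs.v *)
From HB Require Import structures.
From mathcomp Require Import all_boot all_order all_algebra.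
From mathcomp Require Import all_classical all_reals all_analysis.

Set Implicit Arguments.
Unset Strict Implicit.
Unset Printing Implicit Defensive.

Import Order.TTheory GRing.Theory Num.Theory.
Import numFieldNormedType.Exports.

Local Open Scope classical_set_scope.
Local Open Scope ring_scope.

Section Sobolev.
Context {R : realType}.
Local Notation leb := (@lebesgue_measure R).

(** The test space C^1_c(0,1); functions are extended by zero to the line. *)
Definition test_function (phi : R -> R) : Prop :=
  [/\ forall x, derivable phi x 1,
      continuous (derive1 phi) &
      exists a b : R, [/\ 0 < a, b < 1 &
        forall x, x \notin `[a, b] -> phi x = 0]].

Definition L2 (g : R -> R) : Prop :=
  measurable_fun (`]0, 1[ : set R) g /\
  leb.-integrable (`]0, 1[ : set R) (EFin \o (fun x => g x ^+ 2)).

Definition weak_derivative (f g : R -> R) : Prop :=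
  forall phi, test_function phi ->
    \int[leb]_(x in `]0, 1[) (f x * derive1 phi x) =
    - \int[leb]_(x in `]0, 1[) (g x * phi x).

(** [W12 f g]: f is (the continuous representative on [0,1] of) an element of
    W^{1,2}(0,1), with weak derivative g. Point values of f, also at 0 and 1,
    are those of this representative; f in L^2 is implied by its continuity. *)
Definition W12 (f g : R -> R) : Prop :=
  [/\ {within `[0, 1], continuous f}, L2 g & weak_derivative f g].

(** [W22 u du ddu]: u is in W^{2,2}(0,1), u' = du and u'' = ddu weakly. Here du
    is the continuous representative of u', so that du 0 and du 1 are the
    boundary values u'(0) and u'(1). *)
Definition W22 (u du ddu : R -> R) : Prop := W12 u du /\ W12 du ddu.

Definition normW12 (f g : R -> R) : R :=
  Num.sqrt (\int[leb]_(x in `]0, 1[) (f x ^+ 2 + g x ^+ 2)).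

Definition normW22 (u du ddu : R -> R) : R :=
  Num.sqrt (\int[leb]_(x in `]0, 1[) (u x ^+ 2 + du x ^+ 2 + ddu x ^+ 2)).

End Sobolev.

Section Cosserat.
Context {R : realType}.
Local Notation leb := (@lebesgue_measure R).
Implicit Types (mu muc gamma : R) (u du ddu a da : R -> R).

(** E depends on u only through du = u'. *)
Definition energy mu muc du a : R :=
  mu / 2 * \int[leb]_(x in `]0, 1[)
    (du x ^+ 2 + (sin (a x) * du x - 4 * sin (a x / 2) ^+ 2) ^+ 2) +
  muc / 2 * \int[leb]_(x in `]0, 1[)
    ((cos (a x) * du x - 2 * sin (a x)) ^+ 2).

Definition in_X gamma u du ddu : Prop :=
  [/\ W22 u du ddu, u 0 = 0 & u 1 = gamma].

(** [tan] is total in the library (it vanishes where cos does), hence the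
    requirement that the tangents be defined. *)
Definition consistent_coupling du a : Prop :=
  [/\ cos (a 0) != 0, cos (a 1) != 0,
      du 0 = 2 * tan (a 0) & du 1 = 2 * tan (a 1)].

Definition dirichlet (aD : R) du a : Prop := a 0 = aD /\ a 1 = aD.

(** (u, a) solves E -> min over X x W^{1,2}, subject to the additional boundary
    conditions [bc] on u' and a. *)
Definition is_minimizer (bc : (R -> R) -> (R -> R) -> Prop)
    mu muc gamma u a : Prop :=
  exists du ddu da,
    [/\ in_X gamma u du ddu, W12 a da, bc du a &
        forall v dv ddv b db,
          in_X gamma v dv ddv -> W12 b db -> bc dv b ->
          energy mu muc du a <= energy mu muc dv b].

(** Local minimizer in X x W^{1,2} for the W^{2,2} x W^{1,2} norm, without
    boundary conditions on a. *)
Definition is_local_minimizer mu muc gamma u a : Prop :=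
  exists du ddu da,
    [/\ in_X gamma u du ddu, W12 a da &
        exists2 eps : R, 0 < eps &
          forall v dv ddv b db,
            in_X gamma v dv ddv -> W12 b db ->
            normW22 (v \- u) (dv \- du) (ddv \- ddu) < eps ->
            normW12 (b \- a) (db \- da) < eps ->
            energy mu muc du a <= energy mu muc dv b].

Definition euler_lagrange mu muc u a : Prop :=
  exists du ddu da,
    [/\ W22 u du ddu, W12 a da &
        {ae leb, forall x, x \in `]0, 1[ ->
          (2 * mu + (muc - mu) * cos (a x) ^+ 2) * ddu x =
            2 * (muc - mu) *
              (sin (a x) * cos (a x) * du x + cos (a x) ^+ 2 - sin (a x) ^+ 2)
              * da x
            + 2 * mu * cos (a x) * da x
          /\
          0 = (cos (a x) * du x - 2 * sin (a x)) *
              ((mu - muc) * (sin (a x) * du x - 4 * sin (a x / 2) ^+ 2)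
               - 2 * muc)}].

Definition ubar gamma : R -> R := fun x => gamma * x.

Definition const_on01 a (c : R) : Prop := forall x, x \in `[0, 1] -> a x = c.

(** Division by zero yields eta 0 = 0. *)
Definition eta (a : R) : R := 4 * sin (a / 2) ^+ 2 / sin a.

Definition fconst mu muc gamma : R :=
  Num.sqrt ((gamma ^+ 2 + 4) * (mu - muc) ^+ 2 - 4 * mu ^+ 2).

(** The angle t with tan t = n / d on the branch of the inverse tangent in
    ]-pi/2, 3pi/2[ for which cos t has the sign of s * d. It is the principal
    value atan (n / d) whenever s * d > 0. *)
Definition arctan_branch (s n d : R) : R :=
  atan (n / d) + (if s * d < 0 then pi else 0).

(** Equating the second factor of the second Euler-Lagrange equation to zero
    with u' = gamma forces
      cos a = (4 mu -+ gamma f) / ((mu - muc) (gamma^2 + 4)),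
      sin a = (2 gamma mu +- 2 f) / ((mu - muc) (gamma^2 + 4)),
    which determines a modulo 2 pi, whereas tan a = sin a / cos a determines it
    only modulo pi; a + pi does not solve the equation when a does. The branch
    of the inverse tangent is fixed accordingly: cos a has the sign of the
    denominator times that of mu - muc. *)
Definition alpha1m mu muc gamma : R :=
  let f := fconst mu muc gamma in
  arctan_branch (mu - muc) (gamma * mu - f) (2 * mu + gamma / 2 * f).

Definition alpha1p mu muc gamma : R :=
  let f := fconst mu muc gamma in
  arctan_branch (mu - muc) (gamma * mu + f) (2 * mu - gamma / 2 * f).

Definition alpha2 gamma : R := atan (gamma / 2).

(** eta is an increasing bijection from ]-pi, pi[ onto the real line. *)
Definition alpha3 gamma : R :=
  get [set a : R | (a \in `]- pi, pi[) /\ eta a = gamma].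

Definition muc_crit mu gamma : R :=
  mu * (1 - 2 / Num.sqrt (gamma ^+ 2 + 4)).

Definition alpha1_exist mu muc gamma : Prop :=
  4 * mu != gamma * fconst mu muc gamma /\
  ((muc < mu /\ muc <= muc_crit mu gamma) \/
   mu * (1 + 2 / Num.sqrt (gamma ^+ 2 + 4)) <= muc).

End Cosserat.

(* Main.v *)
Require Import Defs.
From HB Require Import structures.
From mathcomp Require Import all_boot all_order all_algebra.
From mathcomp Require Import all_classical all_reals all_analysis.
From mathcomp Require Import measurable_realfun ring lra.

Set Implicit Arguments.
Unset Strict Implicit.
Unset Printing Implicit Defensive.

Import Order.TTheory GRing.Theory Num.Theory.
Import numFieldNormedType.Exports.

Local Open Scope classical_set_scope.
Local Open Scope ring_scope.

(** With p = u', the energy density is best read in the orthonormal frame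
    turned by the angle: for D = p sin a + 2 cos a and B = p cos a - 2 sin a
    one has D^2 + B^2 = p^2 + 4, and the density equals
      mu/2 (p^2 + (D - 2)^2) + muc/2 B^2                     ([densityE]).
    The second Euler-Lagrange equation becomes
      B ((mu - muc) D - 2 mu) = 0                            ([second_factorE]).

    Solutions above [ubar].  The equation gives finitely many values of
    (cos a, sin a): B = 0 is a = alpha2 modulo pi, and (mu - muc) D = 2 mu
    leaves (mu - muc) B = f or - f, which are alpha1m and alpha1p, or 0 and
    alpha3 if muc = 0 ([second_factor_roots], [alpha1m_proj],
    [alpha1p_proj], [alpha3_proj]).  The possible values of a thus form a
    countable set, and a continuous function with values in a countable set is
    constant ([C01_countable_cst]).

    Local minimizers.  If the density has at (gamma, alpha) a supporting
    affine function of p alone, integrating it against the constraint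
    that u' has mean gamma shows that (ubar, alpha) minimizes E
    ([local_minimizer_of_support]).  Completing squares in D and p gives such
    supports for alpha2 and for the roots of the second factor
    ([density_support_alpha2], [density_support_alpha1]).

    Monotonicity.  If u is not monotone, it takes the same value at the ends
    of an interval ]c, d[ on which it is not constant.  Replacing u' and a by
    0 there keeps the mean of u' and lowers the energy, because the density
    dominates mu/2 p^2 and vanishes at (0, 0).  A C^1 cutoff that converges
    to the indicator of the complement of ]c, d[, corrected to restore the
    mean, makes this competitor admissible with the same boundary values; the
    energies converge by dominated convergence ([excursion_flat]).

    Passing from weak derivatives to point values rests on the du
    Bois-Reymond lemma, which yields u(y) - u(x) = int_x^y u'
    ([weak_FTC_itv]). *)

(** * Continuous functions on the unit interval *)

Section UnitInterval.
Context {R : realType}.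
Local Notation leb := (@lebesgue_measure R).
Local Notation C01 f :=
  {within (`[0, 1]%classic : set R), continuous (f : R -> R)}.
Implicit Types f g : R -> R.

Lemma itv01_oo_cc (x : R) : x \in `]0, 1[ -> x \in `[0, 1].
Proof. exact: subset_itv_oo_cc. Qed.

Lemma C01_cst (c : R) : C01 (fun=> c).
Proof. by move=> x; exact: cst_continuous. Qed.

Lemma C01_of_continuous f : continuous f -> C01 f.
Proof. exact: continuous_subspaceT. Qed.

Lemma C01_comp f g : C01 f -> continuous g -> C01 (fun x => g (f x)).
Proof. by move=> cf cg x; apply: continuous_comp; [exact: cf|exact: cg]. Qed.

Lemma C01D f g : C01 f -> C01 g -> C01 (fun x => f x + g x).
Proof. by move=> cf cg x; apply: cvgD; [exact: cf|exact: cg]. Qed.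

Lemma C01B f g : C01 f -> C01 g -> C01 (fun x => f x - g x).
Proof. by move=> cf cg x; apply: cvgB; [exact: cf|exact: cg]. Qed.

Lemma C01M f g : C01 f -> C01 g -> C01 (fun x => f x * g x).
Proof. by move=> cf cg x; apply: cvgM; [exact: cf|exact: cg]. Qed.

Lemma C01X f n : C01 f -> C01 (fun x => f x ^+ n).
Proof.
move=> cf; elim: n => [|n ih]; first exact: C01_cst.
have -> : (fun x => f x ^+ n.+1) = (fun x => f x * f x ^+ n).
  by apply/funext => x; rewrite exprS.
exact: C01M.
Qed.

Lemma C01_measurable f : C01 f -> measurable_fun (`]0, 1[ : set R) f.
Proof.
move=> cf; apply: (@measurable_funS _ _ _ _ (`[0, 1]%classic : set R)) => //.
  exact: subset_itv_oo_cc.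
exact: subspace_continuous_measurable_fun.
Qed.

Lemma C01_integrable_cc f :
  C01 f -> leb.-integrable (`[0, 1]%classic : set R) (EFin \o f).
Proof.
by move=> cf; apply: continuous_compact_integrable => //; exact: segment_compact.
Qed.

Lemma C01_integrable f :
  C01 f -> leb.-integrable (`]0, 1[ : set R) (EFin \o f).
Proof.
move=> /C01_integrable_cc; apply: integrableS => //.
exact: subset_itv_oo_cc.
Qed.

Lemma C01_bounded f : C01 f ->
  exists2 M : R, 0 <= M & forall x, x \in `[0, 1] -> `|f x| <= M.
Proof.
move=> cf; have [|c _ fc] := @EVT_max R (fun x => `|f x|) 0 1 ler01.
  exact: C01_comp cf (@norm_continuous _ _).
by exists `|f c|.
Qed.

Lemma Rintegral01_cc f : C01 f ->
  \int[leb]_(x in `[0, 1]) f x = \int[leb]_(x in `]0, 1[) f x.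
Proof.
move=> cf; rewrite -Rintegral_itv_obnd_cbnd; last first.
  by apply: integrableS (C01_integrable_cc cf) => //; exact: subset_itv_oc_cc.
by rewrite -Rintegral_itv_bndo_bndc//; exact: C01_integrable.
Qed.

Lemma Rintegral01_cst (c : R) : \int[leb]_(x in (`]0, 1[ : set R)) c = c.
Proof.
by rewrite Rintegral_cst//= lebesgue_measure_itv/= lte_fin ltr01 oppr0 adde0 mulr1.
Qed.

(** A null set contains no interval, so f vanishes on the open interval; the
    ends follow by one-sided continuity. *)
Lemma C01_ae_eq0 f : C01 f ->
  {ae leb, forall x, x \in `]0, 1[ -> f x = 0} ->
  forall x, x \in `[0, 1] -> f x = 0.
Proof.
move=> cf [N [mN N0 sN]].
have fo x : x \in `]0, 1[ -> f x = 0.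
  move=> x01; apply: contrapT => /eqP fx0.
  have fx : {for x, continuous f} by exact: within_continuous_continuous cf x01.
  have [e e0 eN] : exists2 e : R, 0 < e & `]x - e, x + e[%classic `<=` N.
    have : \forall y \near x, N y.
      near=> y; apply: sN => /= h.
      have fy0 : f y = 0.
        apply: h; near: y; have := @near_in_itvoo R 0 1 x x01.
        by apply: filterS => y; rewrite inE.
      have : `|f x - f y| < `|f x|.
        by near: y; move/cvgrPdist_lt : fx; apply; rewrite normr_gt0.
      by rewrite fy0 subr0 ltxx.
    move=> /nbhs_ballP[e /= e0 eN]; exists e => // y /=.
    rewrite in_itv/= => /andP[xy yx]; apply: eN.
    by rewrite /ball/= ltr_norml; lra.
  pose A : set R := `]x - e, x + e[%classic.
  have : (leb A <= leb N)%E by apply: le_measure; rewrite ?inE//; exact: measurable_itv.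
  rewrite /A lebesgue_measure_itv/= lte_fin N0.
  rewrite (_ : (x - e < x + e)%R); last by lra.
  by rewrite -EFinD lee_fin; lra.
have [_ f0 f1] := (continuous_within_itvP f ltr01).1 cf.
move=> x; rewrite in_itv/= => /andP[]; rewrite le_eqVlt => /predU1P[<- _|x0].
  apply: (cvg_unique _ f0) => //.
  by apply: cvg_near_cst; near=> y; apply: fo; rewrite in_itv/=; apply/andP.
rewrite le_eqVlt => /predU1P[-> |x1]; last by apply: fo; rewrite in_itv/= x0.
apply: (cvg_unique _ f1) => //.
by apply: cvg_near_cst; near=> y; apply: fo; rewrite in_itv/=; apply/andP.
Unshelve. all: by end_near. Qed.

Lemma C01_Rintegral_eq0 f : C01 f -> (forall x, x \in `]0, 1[ -> 0 <= f x) ->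
  \int[leb]_(x in `]0, 1[) f x = 0 -> forall x, x \in `[0, 1] -> f x = 0.
Proof.
move=> cf f0 if0; apply: C01_ae_eq0 => //.
have mf := C01_measurable cf.
pose A : set R := `]0, 1[%classic.
have : (\int[leb]_(x in A) `|(f x)%:E| = 0)%E.
  rewrite -[RHS]/(0%:E) -if0 /Rintegral fineK; last first.
    by apply: integrable_fin_num => //; exact: C01_integrable.
  by apply: eq_integral => x; rewrite inE/= => x01; rewrite ger0_norm// f0.
have mfE : measurable_fun A (EFin \o f) by exact/measurable_EFinP.
move/(ae_eq_integral_abs leb (measurable_itv _) mfE) => -[N [mN N0 sN]].
exists N; split => // x /= h; apply: sN => /= h'.
by apply: h => x01; have [] := h' x01.
Qed.

End UnitInterval.

(** * Classical derivatives are weak derivatives *)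

Section WeakDerivative.
Context {R : realType}.
Local Notation leb := (@lebesgue_measure R).
Local Notation C01 f :=
  {within (`[0, 1]%classic : set R), continuous (f : R -> R)}.
Implicit Types f g u p phi : R -> R.

Lemma test_function_continuous phi : test_function phi -> continuous phi.
Proof.
by move=> [dphi _ _] x; apply/differentiable_continuous/derivable1_diffP.
Qed.

Lemma test_function_ends phi : test_function phi -> phi 0 = 0 /\ phi 1 = 0.
Proof.
move=> [_ _ [a [b [a0 b1 phi0]]]]; split; apply: phi0.
  by rewrite in_itv/= leNgt a0.
by rewrite in_itv/= [_ <= b]leNgt b1 andbF.
Qed.

Lemma C01_derivable_oo_LR f : C01 f -> {in `]0, 1[, forall x, derivable f x 1} ->
  derivable_oo_LRcontinuous f 0 1.
Proof. by move=> /(continuous_within_itvP f ltr01)[_ f0 f1]. Qed.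

Lemma weak_derivative_C1 f g : C01 f -> C01 g ->
  {in `]0, 1[, forall x : R, is_derive x (1 : R) f (g x)} -> weak_derivative f g.
Proof.
move=> cf cg dfg phi tphi.
have cphi := test_function_continuous tphi.
have [phi0 phi1] := test_function_ends tphi.
have [dphi cdphi _] := tphi.
have Cphi := C01_of_continuous cphi.
have Cdphi := C01_of_continuous cdphi.
rewrite -Rintegral01_cc; last exact: C01M.
rewrite (@Rintegration_by_parts _ f phi g (derive1 phi))//.
- rewrite phi0 phi1 !mulr0 subr0 sub0r; congr (- _).
  by rewrite Rintegral01_cc//; exact: C01M.
- by apply: C01_derivable_oo_LR => // x x01; have [] := dfg x x01.
- by move=> x x01; rewrite derive1E; have [_ ->] := dfg x x01.
- exact: C01_derivable_oo_LR.
Qed.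

Lemma C01_L2 f : C01 f -> L2 f.
Proof.
move=> cf; split; first exact: C01_measurable.
exact: C01_integrable (C01X cf).
Qed.

Lemma W12_C1 f g : C01 f -> C01 g ->
  {in `]0, 1[, forall x : R, is_derive x (1 : R) f (g x)} -> W12 f g.
Proof.
by move=> cf cg fg; split; [|exact: C01_L2|exact: weak_derivative_C1].
Qed.

Definition primitive01 p (x : R) : R := \int[leb]_(t in `[0, x]) p t.

Lemma primitive01_0 p : primitive01 p 0 = 0.
Proof. by rewrite /primitive01 set_itv1 Rintegral_set1. Qed.

Lemma primitive01_1 p : C01 p ->
  primitive01 p 1 = \int[leb]_(t in `]0, 1[) p t.
Proof. exact: Rintegral01_cc. Qed.

Lemma primitive01_C01 p : C01 p -> C01 (primitive01 p).
Proof.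
move=> cp; apply: parameterized_integral_continuous; first exact: ler01.
exact: C01_integrable_cc.
Qed.

Lemma primitive01_is_derive p (x : R) : C01 p -> x \in `]0, 1[ ->
  is_derive x (1 : R) (primitive01 p) (p x).
Proof.
move=> cp x01; have /= := x01; rewrite in_itv/= => /andP[x0 x1].
have [||d1] := continuous_FTC1_closed x1 (C01_integrable_cc cp) _ _.
- exact: x0.
- exact: within_continuous_continuous cp x01.
by rewrite derive1E => d2; apply: DeriveDef.
Qed.

Lemma W12_primitive01 p : C01 p -> W12 (primitive01 p) p.
Proof.
move=> cp; apply: W12_C1 => //; first exact: primitive01_C01.
by move=> x; exact: primitive01_is_derive.
Qed.

Lemma is_deriveM_fun f g (x a b : R) :
  is_derive x (1 : R) f a -> is_derive x (1 : R) g b ->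
  is_derive x (1 : R) (fun x => f x * g x) (f x * b + g x * a).
Proof. by move=> df dg; exact: is_deriveM. Qed.

(** The simplest C^1 function that vanishes exactly on a half-line: all test
    functions and cutoffs below are built from it. *)
Definition relu2 (x : R) : R := Num.max 0 x ^+ 2.

Lemma relu2_is_derive (x : R) : is_derive x (1 : R) relu2 (2 * Num.max 0 x).
Proof.
have [x0|x0|->] := ltgtP x 0.
- rewrite mulr0.
  apply: (@near_eq_is_derive _ _ _ (cst 0)).
  by near=> y; rewrite /relu2 max_l ?expr0n// ltW//; near: y; exact: lt_nbhsl.
- rewrite (_ : 2 * x = x * 1 + x * 1); last by ring.
  apply: near_eq_is_derive (is_deriveM_fun (is_derive_id _ _) (is_derive_id _ _)).
  near=> y; rewrite /relu2 max_r ?expr2// ltW//; near: y; exact: lt_nbhsr.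
- rewrite mulr0.
  have h : h^-1 *: (relu2 (h *: 1 + 0) - relu2 0) @[h --> 0^'] --> (0 : R).
    apply/cvgr0Pnorm_le => e e0; near=> h.
    rewrite scaler1 addr0 /relu2 maxxx expr0n/= subr0 /GRing.scale/=.
    have hn0 : h != 0 by near: h; exact: nbhs_dnbhs_neq.
    have he : `|h| <= e by near: h; apply: dnbhs0_le.
    rewrite normrM normfV ler_pdivrMl ?normr_gt0// normrX.
    have [h0|h0] := leP 0 h.
      by rewrite ger0_norm// expr2 ler_wpM2l// -[X in X <= _]ger0_norm.
    by rewrite normr0 expr0n/= mulr_ge0// ltW.
  apply: DeriveDef.
    by rewrite /derivable; apply/cvg_ex; exists 0.
  exact: cvg_lim h.
Unshelve. all: by end_near. Qed.

Lemma max0_continuous : continuous (fun x : R => Num.max 0 x).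
Proof. by move=> x; apply: continuous_max; [exact: cst_continuous|]. Qed.

End WeakDerivative.

(** * The du Bois-Reymond lemma *)

Section DuBoisReymond.
Context {R : realType}.
Local Notation leb := (@lebesgue_measure R).
Local Notation C01 f :=
  {within (`[0, 1]%classic : set R), continuous (f : R -> R)}.
Implicit Types f g u p w phi : R -> R.

(** The second difference of [relu2] with increment d: a C^1 step that rises
    from 0 to 2 d^2 on [c - d, c + d]. *)
Definition step (c d x : R) : R :=
  relu2 (x - c + d) - 2 * relu2 (x - c) + relu2 (x - c - d).

(** The derivative of [step], a nonnegative bump around c. *)
Definition tent (c d x : R) : R :=
  2 * (Num.max 0 (x - c + d) - 2 * Num.max 0 (x - c) + Num.max 0 (x - c - d)).

Lemma relu2_shift_is_derive (c x : R) :
  is_derive x (1 : R) (fun x => relu2 (x + c)) (2 * Num.max 0 (x + c)).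
Proof.
have h : is_derive x (1 : R) (fun x => x + c) 1.
  by apply: is_derive_eq; rewrite addr0.
have := @is_derive1_comp R relu2 (fun x => x + c) x _ _ (relu2_is_derive _) h.
by rewrite mulr1.
Qed.

Lemma step_is_derive (c d x : R) : is_derive x (1 : R) (step c d) (tent c d x).
Proof.
have -> : step c d = (fun x => relu2 (x + (- c + d)) - 2 * relu2 (x + (- c))
    + relu2 (x + (- c - d))).
  by apply/funext => y; rewrite /step !addrA.
have h := relu2_shift_is_derive.
have -> : tent c d x = 2 * Num.max 0 (x + (- c + d)) -
   2 * (2 * Num.max 0 (x + (- c))) + 2 * Num.max 0 (x + (- c - d)).
  by rewrite /tent !addrA; ring.
apply: is_deriveD; apply: is_deriveB.
Qed.

Lemma tent_continuous (c d : R) : continuous (tent c d).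
Proof.
have m0 (e : R) : continuous (fun x : R => Num.max 0 (x + e)).
  move=> x; apply: (@continuous_comp _ _ _ (fun x : R => x + e)).
    by apply: cvgD; [exact: cvg_id|exact: cvg_cst].
  exact: max0_continuous.
have -> : tent c d = (fun x => 2 * (Num.max 0 (x + (- c + d)) -
   2 * Num.max 0 (x + (- c)) + Num.max 0 (x + (- c - d)))).
  by apply/funext => x; rewrite /tent !addrA.
move=> x; apply: cvgM; first exact: cvg_cst.
apply: cvgD; last exact: m0.
apply: cvgB; first exact: m0.
by apply: cvgM; [exact: cvg_cst|exact: m0].
Qed.

Lemma tent_ge0 (c d x : R) : 0 < d -> 0 <= tent c d x.
Proof.
move=> d0; rewrite /tent.
by case: (ltgtP 0 (x - c + d)); case: (ltgtP 0 (x - c)); case: (ltgtP 0 (x - c - d)); lra.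
Qed.

Lemma tent_gt0 (c d : R) : 0 < d -> 0 < tent c d c.
Proof.
move=> d0; rewrite /tent subrr add0r sub0r maxxx.
by case: (ltgtP 0 d); case: (ltgtP 0 (- d)); lra.
Qed.

Lemma tent_supp (c d x : R) : 0 < d -> tent c d x != 0 -> `|x - c| < d.
Proof.
move=> d0; apply: contraR; rewrite -leNgt ler_normr /tent.
move=> /orP[h|h]; apply/eqP;
by case: (ltgtP 0 (x - c + d)); case: (ltgtP 0 (x - c)); case: (ltgtP 0 (x - c - d)); lra.
Qed.

Lemma step_left (c d x : R) : 0 < d -> x <= c - d -> step c d x = 0.
Proof.
by move=> d0 xc; rewrite /step /relu2 !max_l ?expr0n/=; lra.
Qed.

Lemma step_right (c d x : R) : 0 < d -> c + d <= x -> step c d x = 2 * d ^+ 2.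
Proof.
by move=> d0 xc; rewrite /step /relu2 !max_r; [ring|lra..].
Qed.

(** The difference of two steps of equal height has compact support although
    neither of them has, and its derivative is a bump at y minus a bump at x. *)
Lemma test_function_stepB (x y d : R) : 0 < d -> d < x -> d < 1 - x ->
  d < y -> d < 1 - y -> test_function (fun t => step y d t - step x d t) /\
   derive1 (fun t => step y d t - step x d t) = (fun t => tent y d t - tent x d t).
Proof.
move=> d0 dx dx1 dy dy1.
have D t : is_derive t (1 : R) (fun t => step y d t - step x d t)
    (tent y d t - tent x d t).
  by apply: is_deriveB; exact: step_is_derive.
have E : derive1 (fun t => step y d t - step x d t) =
    (fun t => tent y d t - tent x d t).
  by apply/funext => t; rewrite derive1E; have [_ ->] := D t.
split => //; split; first by move=> t; have [] := D t.
  by rewrite E => t; apply: cvgB; exact: tent_continuous.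
exists (Num.min x y - d), (Num.max x y + d); split.
- by rewrite subr_gt0 lt_min dx dy.
- by rewrite -ltrBrDr gt_max; apply/andP; split; lra.
move=> t; rewrite in_itv/= negb_and -!ltNge => /orP[h|h].
  have : t + d < Num.min x y by rewrite -ltrBrDr.
  rewrite lt_min => /andP[h1 h2].
  by rewrite !step_left ?subrr//; lra.
have : Num.max x y < t - d by rewrite ltrBrDr.
rewrite gt_max => /andP[h1 h2].
by rewrite !step_right ?subrr//; lra.
Qed.

Lemma Rintegral_derive_test phi : test_function phi ->
  \int[leb]_(x in `]0, 1[) derive1 phi x = 0.
Proof.
move=> tphi.
have h : weak_derivative (cst 1) (cst (0 : R)).
  apply: weak_derivative_C1; [exact: C01_cst|exact: C01_cst|].
  by move=> x _; exact: is_derive_cst.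
have := h _ tphi.
under eq_Rintegral do rewrite /cst mul1r.
by under [in X in _ = - X]eq_Rintegral do rewrite /cst mul0r; rewrite Rintegral01_cst oppr0.
Qed.

(** Testing with a function whose derivative is a bump at y minus a bump at x
    compares the averages of w near x and near y. If w x < w y, and m lies
    between them, then the integrand (w - m) phi' is nonnegative and nonzero,
    while its integral is 0. *)
Lemma duBois_Reymond w : C01 w -> weak_derivative w (cst 0) ->
  forall x, x \in `[0, 1] -> w x = w 0.
Proof.
move=> cw wd.
have main x y : x \in `]0, 1[ -> y \in `]0, 1[ -> ~ (w x < w y).
  move=> x01 y01 xy; pose m := (w x + w y) / 2.
  have wxm : w x < m by rewrite /m; lra.
  have wym : m < w y by rewrite /m; lra.
  have cx : {for x, continuous w} := within_continuous_continuous ltr01 cw x01.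
  have cy : {for y, continuous w} := within_continuous_continuous ltr01 cw y01.
  have /nbhs_ballP[e1 /= e10 b1] : \forall t \near x, w t < m.
    exact: (cvgr_lt _ cx).
  have /nbhs_ballP[e2 /= e20 b2] : \forall t \near y, m < w t.
    exact: (cvgr_gt _ cy).
  move: (x01) (y01); rewrite !in_itv/= => /andP[x0 x1] /andP[y0 y1].
  near (0 : R)^'+ => d.
  have d0 : 0 < d by [].
  have de1 : d < e1 by near: d; exact: nbhs_right_lt.
  have de2 : d < e2 by near: d; exact: nbhs_right_lt.
  have dx0 : d < x by near: d; exact: nbhs_right_lt.
  have dx1 : d < 1 - x by near: d; apply: nbhs_right_lt; rewrite subr_gt0.
  have dy0 : d < y by near: d; exact: nbhs_right_lt.
  have dy1 : d < 1 - y by near: d; apply: nbhs_right_lt; rewrite subr_gt0.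
  have [tphi dphi] := test_function_stepB d0 dx0 dx1 dy0 dy1.
  have cT := @tent_continuous.
  have CT c : C01 (tent c d) := C01_of_continuous (cT c d).
  have hy t : 0 <= (w t - m) * tent y d t.
    have [->|/(tent_supp d0) h] := eqVneq (tent y d t) 0; first by rewrite mulr0.
    rewrite mulr_ge0 ?tent_ge0// subr_ge0 ltW//; apply: b2.
    by rewrite /ball/= distrC (lt_trans h).
  have hx t : 0 <= (m - w t) * tent x d t.
    have [->|/(tent_supp d0) h] := eqVneq (tent x d t) 0; first by rewrite mulr0.
    rewrite mulr_ge0 ?tent_ge0// subr_ge0 ltW//; apply: b1.
    by rewrite /ball/= distrC (lt_trans h).
  have CB : C01 (fun t => tent y d t - tent x d t) by exact: C01B.
  have I1 := wd _ tphi; have I2 := Rintegral_derive_test tphi.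
  rewrite dphi in I1 I2.
  have := @C01_Rintegral_eq0 R (fun t => w t * (tent y d t - tent x d t)
     - m * (tent y d t - tent x d t)) _ _ _ y (itv01_oo_cc y01).
  have -> : w y * (tent y d y - tent x d y) - m * (tent y d y - tent x d y)
     = (w y - m) * tent y d y + (m - w y) * tent x d y by ring.
  move=> h; have : 0 < (w y - m) * tent y d y + (m - w y) * tent x d y.
    by rewrite ltr_wpDr// mulr_gt0 ?tent_gt0// subr_gt0.
  rewrite h ?ltxx//.
  - by apply: C01B; apply: C01M => //; exact: C01_cst.
  - by move=> t _; have := hx t; have := hy t; lra.
  - rewrite RintegralB//; first last.
    + by apply: C01_integrable; apply: C01M => //; exact: C01_cst.
    + by apply: C01_integrable; apply: C01M.
    rewrite I1 RintegralZl//; last exact: C01_integrable.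
    rewrite I2 mulr0 subr0.
    under eq_Rintegral do rewrite /cst mul0r.
    by rewrite Rintegral01_cst oppr0.
have h01 : (2^-1 : R) \in `]0, 1[ by rewrite in_itv/=; lra.
(* The midpoint serves as an interior reference value; 0 is not interior. *)
have eq0 x : x \in `[0, 1] -> w x - w 2^-1 = 0.
  apply: (@C01_ae_eq0 R (fun x => w x - w 2^-1)).
    by apply: C01B => //; exact: C01_cst.
  apply/aeW => t t01; have := main _ _ t01 h01; have := main _ _ h01 t01.
  by case: (ltgtP (w t) (w 2^-1)) => // ->; rewrite subrr.
move=> x x01; have := eq0 _ x01; have := eq0 0.
by rewrite in_itv/= lexx ler01 => /(_ isT); lra.
Unshelve. all: by end_near. Qed.

(** The function u - int p has weak derivative 0. *)
Lemma weak_FTC u p : C01 u -> C01 p -> weak_derivative u p ->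
  forall x, x \in `[0, 1] -> u x = u 0 + primitive01 p x.
Proof.
move=> cu cp up x x01.
have cP := primitive01_C01 cp.
have [_ _ Pp] := W12_primitive01 cp.
have : weak_derivative (fun x => u x - primitive01 p x) (cst 0).
  move=> phi tphi; have [_ cdphi _] := tphi.
  have Cd := C01_of_continuous cdphi.
  under eq_Rintegral do rewrite mulrBl.
  rewrite RintegralB//; first last.
  - by apply: C01_integrable; exact: C01M.
  - by apply: C01_integrable; exact: C01M.
  rewrite up// Pp// subrr.
  under eq_Rintegral do rewrite /cst mul0r.
  by rewrite Rintegral01_cst oppr0.
move=> /(duBois_Reymond (C01B cu cP)) /(_ _ x01).
by rewrite primitive01_0; lra.
Qed.

End DuBoisReymond.

(** * Sums and products in the Sobolev classes *)

Section SobolevOperations.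
Context {R : realType}.
Local Notation leb := (@lebesgue_measure R).
Local Notation C01 f :=
  {within (`[0, 1]%classic : set R), continuous (f : R -> R)}.
Implicit Types f g u p phi chi : R -> R.

Let mI : measurable (`]0, 1[%classic : set (measurableTypeR R)).
Proof. exact: measurable_itv. Qed.

Lemma L2_of_le f g : measurable_fun (`]0, 1[ : set R) f ->
  leb.-integrable (`]0, 1[ : set R) (EFin \o g) ->
  (forall x, x \in `]0, 1[ -> f x ^+ 2 <= g x) -> L2 f.
Proof.
move=> mf ig fg; split => //; apply: le_integrable ig => //.
  by apply/measurable_EFinP; exact: measurable_funX.
move=> x /= x01; rewrite lee_fin ger0_norm ?sqr_ge0//.
by rewrite (le_trans (fg _ x01))// ler_norm.
Qed.

Lemma L2D f g : L2 f -> L2 g -> L2 (fun x => f x + g x).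
Proof.
move=> [mf f2] [mg g2].
apply: (@L2_of_le _ (fun x => 2 * (f x ^+ 2) + 2 * (g x ^+ 2))).
- exact: measurable_funD.
- have hf := @integrableZl _ _ _ leb _ mI 2 _ f2.
  have hg := @integrableZl _ _ _ leb _ mI 2 _ g2.
  have h := integrableD mI hf hg.
  by apply: eq_integrable h => // x _; rewrite /= EFinD !EFinM.
- by move=> x _; have := sqr_ge0 (f x - g x); rewrite sqrrB sqrrD; lra.
Qed.

Lemma L2_C01M f g : C01 f -> L2 g -> L2 (fun x => f x * g x).
Proof.
move=> cf [mg g2]; have [M M0 fM] := C01_bounded cf.
apply: (@L2_of_le _ (fun x => M ^+ 2 * (g x ^+ 2))).
- by apply: measurable_funM => //; exact: C01_measurable.
- have h := @integrableZl _ _ _ leb _ mI (M ^+ 2) _ g2.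
  by apply: eq_integrable h => // x _; rewrite /= EFinM.
- move=> x /itv01_oo_cc x01; rewrite exprMn ler_wpM2r ?sqr_ge0//.
  by rewrite -[leLHS]real_normK ?num_real// lerXn2r ?nnegrE// fM.
Qed.

Lemma L2_mul_integrable f g : L2 f -> L2 g ->
  leb.-integrable (`]0, 1[ : set R) (EFin \o (fun x => f x * g x)).
Proof.
move=> [mf f2] [mg g2].
apply: le_integrable (integrableD mI f2 g2) => //.
  by apply/measurable_EFinP; exact: measurable_funM.
move=> x _ /=; rewrite lee_fin (@ger0_norm _ (_ + _)); last first.
  by rewrite addr_ge0// sqr_ge0.
rewrite ler_norml.
have := sqr_ge0 (f x - g x); have := sqr_ge0 (f x + g x).
rewrite sqrrB sqrrD; have := sqr_ge0 (f x); have := sqr_ge0 (g x).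
by move=> *; apply/andP; split; lra.
Qed.

Lemma test_functionM chi dchi phi : (forall x, is_derive x (1 : R) chi (dchi x)) ->
  continuous dchi -> test_function phi ->
  test_function (fun x => chi x * phi x) /\
  derive1 (fun x => chi x * phi x) =
    (fun x => chi x * derive1 phi x + phi x * dchi x).
Proof.
move=> dc cdc tphi; have cphi := test_function_continuous tphi.
have [dphi cdphi [a [b [a0 b1 phi0]]]] := tphi.
have cc : continuous chi.
  by move=> x; apply/differentiable_continuous/derivable1_diffP; have [] := dc x.
have D x : is_derive x (1 : R) (fun x => chi x * phi x)
    (chi x * derive1 phi x + phi x * dchi x).
  by apply: is_deriveM_fun => //; apply: DeriveDef => //; rewrite derive1E.
have E : derive1 (fun x => chi x * phi x) =
    (fun x => chi x * derive1 phi x + phi x * dchi x).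
  by apply/funext => x; rewrite derive1E; have [_ ->] := D x.
split; last exact: E.
split; first by move=> x; have [] := D x.
- rewrite E => x; apply: cvgD; apply: cvgM.
  + exact: cc.
  + exact: cdphi.
  + exact: cphi.
  + exact: cdc.
- by exists a, b; split => // x /phi0 ->; rewrite mulr0.
Qed.

(** The product chi phi is again a test function, so the product rule is moved
    onto the test side. *)
Lemma W12M chi dchi f g : (forall x, is_derive x (1 : R) chi (dchi x)) ->
  continuous dchi -> W12 f g ->
  W12 (fun x => chi x * f x) (fun x => chi x * g x + dchi x * f x).
Proof.
move=> dc cdc [cf g2 fg].
have cc : continuous chi.
  by move=> x; apply/differentiable_continuous/derivable1_diffP; have [] := dc x.
have Cc := C01_of_continuous cc; have Cdc := C01_of_continuous cdc.
split.
- exact: C01M.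
- by apply: L2D; [exact: L2_C01M|apply: C01_L2; exact: C01M].
move=> phi tphi; have [tcp cpE] := test_functionM dc cdc tphi.
have [dphi cdphi _] := tphi.
have Cphi := C01_of_continuous (test_function_continuous tphi).
have Cdphi := C01_of_continuous cdphi.
have := fg _ tcp; rewrite cpE.
have -> : \int[leb]_(x in `]0, 1[) (f x * (chi x * derive1 phi x + phi x * dchi x))
  = \int[leb]_(x in `]0, 1[) (chi x * f x * derive1 phi x) +
    \int[leb]_(x in `]0, 1[) (dchi x * f x * phi x).
  rewrite -RintegralD//.
  - by apply: eq_Rintegral => x _; ring.
  - by apply: C01_integrable; apply: C01M => //; exact: C01M.
  - by apply: C01_integrable; apply: C01M => //; exact: C01M.
have -> : \int[leb]_(x in `]0, 1[) ((chi x * g x + dchi x * f x) * phi x)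
  = \int[leb]_(x in `]0, 1[) (g x * (chi x * phi x)) +
    \int[leb]_(x in `]0, 1[) (dchi x * f x * phi x).
  rewrite -RintegralD//.
  - by apply: eq_Rintegral => x _; ring.
  - by apply: L2_mul_integrable => //; apply: C01_L2; exact: C01M.
  - by apply: C01_integrable; apply: C01M => //; exact: C01M.
by lra.
Qed.

Lemma W12D f g df dg : W12 f df -> W12 g dg ->
  W12 (fun x => f x + g x) (fun x => df x + dg x).
Proof.
move=> [cf f2 fdf] [cg g2 gdg]; split; [exact: C01D|exact: L2D|].
move=> phi tphi; have [dphi cdphi _] := tphi.
have Cphi := C01_of_continuous (test_function_continuous tphi).
have Cdphi := C01_of_continuous cdphi.
under eq_Rintegral do rewrite mulrDl.
under [in RHS]eq_Rintegral do rewrite mulrDl.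
rewrite !RintegralD//.
- by rewrite fdf// gdg// opprD.
- by apply: L2_mul_integrable => //; exact: C01_L2.
- by apply: L2_mul_integrable => //; exact: C01_L2.
- by apply: C01_integrable; exact: C01M.
- by apply: C01_integrable; exact: C01M.
Qed.

Lemma W12_cst (c : R) : W12 (cst c) (cst 0).
Proof.
apply: W12_C1; [exact: C01_cst|exact: C01_cst|].
by move=> x _; exact: is_derive_cst.
Qed.

Lemma W22_ubar gamma : W22 (ubar gamma) (cst gamma) (cst (0 : R)).
Proof.
split; last exact: W12_cst.
apply: W12_C1; [|exact: C01_cst|].
  by apply: C01M; [exact: C01_cst|apply: C01_of_continuous => x; exact: cvg_id].
move=> x _; have := is_deriveM_fun (is_derive_cst gamma x (1 : R)) (is_derive_id x (1 : R)).
by rewrite mulr1 mulr0 addr0.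
Qed.

Lemma in_X_ubar gamma : in_X gamma (ubar gamma) (cst gamma) (cst (0 : R)).
Proof. by split; [exact: W22_ubar|rewrite /ubar mulr0|rewrite /ubar mulr1]. Qed.

(** The only way in which the constraint u(1) - u(0) = gamma enters the energy
    estimates. *)
Lemma in_X_Rintegral gamma u p q : in_X gamma u p q ->
  \int[leb]_(x in `]0, 1[) p x = gamma.
Proof.
move=> [[[cu _ up] [cp _ _]] u0 u1].
have := weak_FTC cu cp up (x := 1).
rewrite u0 u1 add0r primitive01_1// => <-//.
by rewrite in_itv/= lexx ler01.
Qed.

Lemma W22_ubar_unique gamma p q : W22 (ubar gamma) p q ->
  forall x, x \in `]0, 1[ -> p x = gamma.
Proof.
move=> [[cu _ up] [cp _ _]] x x01.
have dp := primitive01_is_derive cp x01.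
have du : is_derive x (1 : R) (ubar gamma) gamma.
  have := is_deriveM_fun (is_derive_cst gamma x (1 : R)) (is_derive_id x (1 : R)).
  by rewrite mulr1 mulr0 addr0.
have : is_derive x (1 : R) (ubar gamma) (p x).
  apply: near_eq_is_derive dp.
  have := @near_in_itvoo R 0 1 x x01; apply: filterS => y; rewrite inE => y01.
  have := weak_FTC cu cp up (itv01_oo_cc y01).
  by rewrite {2}/ubar mulr0 add0r.
by move=> [_ <-]; have [_ ->] := du.
Qed.

End SobolevOperations.

(** * Angles *)

Section Angles.
Context {R : realType}.
Implicit Types x y a : R.

Lemma sin_natMpi (n : nat) : sin (n%:R * pi) = 0 :> R.
Proof.
elim: n => [|n ih]; first by rewrite mul0r sin0.
by rewrite -natr1 mulrDl mul1r sinDpi ih oppr0.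
Qed.

Lemma sin_intMpi (k : int) : sin (k%:~R * pi) = 0 :> R.
Proof.
by case: k => n; rewrite ?NegzE ?mulrNz ?mulNr ?sinN -pmulrn sin_natMpi// oppr0.
Qed.

Lemma sin_eq0_pi x : sin x = 0 -> exists k : int, x = k%:~R * pi.
Proof.
move=> sx; pose k := Num.floor (x / pi); exists k.
have p0 := pi_gt0 R.
have /andP[k1 k2] : k%:~R <= x / pi < (k + 1)%:~R.
  by rewrite floor_le_tmp floorD1_gt.
pose y := x - k%:~R * pi.
have sy : sin y = 0 by rewrite /y sinB sx sin_intMpi mul0r mulr0 subrr.
have y0 : 0 <= y by rewrite /y subr_ge0 -ler_pdivlMr.
have y1 : y < pi.
  by rewrite /y ltrBlDr -[X in X + _]mul1r -mulrDl -ltr_pdivrMr// addrC -intrD1.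
apply/eqP; rewrite -subr_eq0 -/y; apply: contraT => yn0.
have : 0 < sin y by apply: sin_gt0_pi; rewrite lt_def yn0 y0 y1.
by rewrite sy ltxx.
Qed.

Lemma half_angle a : 4 * sin (a / 2) ^+ 2 = 2 - 2 * cos a.
Proof.
have {2}-> : a = a / 2 + a / 2 by field.
by rewrite cosD -!expr2 cos2sin2; ring.
Qed.

Lemma cos_eq1_2pi x : cos x = 1 -> exists k : int, x = k%:~R * (2 * pi).
Proof.
move=> cx; have [|k xk] := @sin_eq0_pi (x / 2).
  by apply/eqP; rewrite -sqrf_eq0; apply/eqP; have := half_angle x; rewrite cx; lra.
by exists k; rewrite mulrCA -xk; field.
Qed.

Lemma cos_sin_inj x y : cos x = cos y -> sin x = sin y ->
  exists k : int, x = y + k%:~R * (2 * pi).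
Proof.
move=> cxy sxy; have [|k xk] := @cos_eq1_2pi (x - y).
  by rewrite cosB cxy sxy -!expr2 cos2Dsin2.
by exists k; rewrite -xk; ring.
Qed.

(** Stated with an arbitrary square root rho of n^2 + d^2, of either sign, to
    serve both branches of [arctan_branch]. *)
Lemma cos_atan_div (n d rho : R) : d != 0 -> rho ^+ 2 = n ^+ 2 + d ^+ 2 ->
  cos (atan (n / d)) = `|d / rho|.
Proof.
move=> d0 rE.
have r0 : rho != 0.
  rewrite -sqrf_eq0 rE gt_eqF// ltr_wpDl ?sqr_ge0//.
  by rewrite lt_def sqr_ge0 sqrf_eq0 d0.
rewrite cos_atan (_ : 1 + (n / d) ^+ 2 = (rho / d) ^+ 2).
  by rewrite sqrtr_sqr -normfV invf_div.
by rewrite [RHS]expr_div_n rE; field.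
Qed.

(** The branch selects the angle of the vector (d, n) if rho > 0 and of its
    opposite if rho < 0; the hypothesis says that rho has the sign of s. *)
Lemma arctan_branch_cos_sin (s n d rho : R) : d != 0 ->
  rho ^+ 2 = n ^+ 2 + d ^+ 2 -> 0 < s * rho ->
  cos (arctan_branch s n d) = d / rho /\ sin (arctan_branch s n d) = n / rho.
Proof.
move=> d0 rE sr; have ca := cos_atan_div d0 rE.
have r0 : rho != 0 by apply: contraTneq sr => ->; rewrite mulr0 ltxx.
have dr0 : d / rho != 0 by rewrite mulf_neq0 ?invr_neq0.
have ca0 : cos (atan (n / d)) != 0 by rewrite ca normr_eq0.
have sa : sin (atan (n / d)) = n / d * `|d / rho|.
  by rewrite -ca -{2}(atanK (n / d)) /tan divfK.
have E : s * d = (s * rho) * (d / rho) by field.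
rewrite /arctan_branch; case: ifPn; rewrite E.
- rewrite pmulr_rlt0// => dr; rewrite cosDpi sinDpi ca sa ltr0_norm// opprK.
  by split => //; field; rewrite r0 d0.
- rewrite -leNgt pmulr_rge0// => dr; rewrite addr0 ca sa ger0_norm//.
  by split => //; field; rewrite r0 d0.
Qed.

End Angles.

(** * The energy density and its supporting lines *)

Section Density.
Context {R : realType}.
Implicit Types mu muc gamma p a b : R.

(** The integrand of [energy] as a function of the strain p = u' and the angle. *)
Definition density mu muc p a : R :=
  mu / 2 * (p ^+ 2 + (sin a * p - 4 * sin (a / 2) ^+ 2) ^+ 2) +
  muc / 2 * (cos a * p - 2 * sin a) ^+ 2.

(** The vector (2, p) in the orthonormal frame (cos a, sin a), (- sin a, cos a):
    [proj] and [coproj] are its two coordinates. *)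
Definition proj p a : R := p * sin a + 2 * cos a.

Definition coproj p a : R := p * cos a - 2 * sin a.

Lemma proj_coproj p a : proj p a ^+ 2 + coproj p a ^+ 2 = p ^+ 2 + 4.
Proof.
have h := cos2Dsin2 a; rewrite /proj /coproj.
rewrite (_ : _ + _ = (p ^+ 2 + 4) * (cos a ^+ 2 + sin a ^+ 2)); last by ring.
by rewrite h mulr1.
Qed.

Lemma densityE mu muc p a : density mu muc p a =
  mu / 2 * (p ^+ 2 + (proj p a - 2) ^+ 2) + muc / 2 * coproj p a ^+ 2.
Proof. by rewrite /density half_angle /proj /coproj; congr (_ + _); ring. Qed.

Lemma radius_gt0 gamma : 0 < Num.sqrt (gamma ^+ 2 + 4).
Proof. by rewrite sqrtr_gt0 ltr_wpDl// sqr_ge0. Qed.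

Lemma sqr_radius gamma : Num.sqrt (gamma ^+ 2 + 4) ^+ 2 = gamma ^+ 2 + 4.
Proof. by rewrite sqr_sqrtr// addr_ge0// sqr_ge0. Qed.

Lemma radius_gt1 gamma : 1 < Num.sqrt (gamma ^+ 2 + 4).
Proof.
rewrite -(@ltr_pXn2r _ 2)// ?nnegrE ?sqrtr_ge0// sqr_radius expr1n.
by rewrite ltr_wpDl ?sqr_ge0// ltr1n.
Qed.

Lemma alpha2_cos_sin gamma (r := Num.sqrt (gamma ^+ 2 + 4)) :
  cos (alpha2 gamma) = 2 / r /\ sin (alpha2 gamma) = gamma / r.
Proof.
have h : r ^+ 2 = gamma ^+ 2 + 2 ^+ 2 by rewrite sqr_radius; ring.
have r0 : 0 < r := radius_gt0 gamma.
have r0' : 0 < 1 * r by rewrite mul1r.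
have := @arctan_branch_cos_sin R 1 gamma 2 r (lt0r_neq0 (ltr0Sn R 1)) h r0'.
by rewrite /arctan_branch mul1r ltNge ler0n addr0.
Qed.

Lemma coproj_alpha2 gamma : coproj gamma (alpha2 gamma) = 0.
Proof. by rewrite /coproj; have [-> ->] := alpha2_cos_sin gamma; ring. Qed.

Lemma proj_alpha2 gamma :
  proj gamma (alpha2 gamma) = Num.sqrt (gamma ^+ 2 + 4).
Proof.
rewrite /proj; have [-> ->] := alpha2_cos_sin gamma.
have r0 := radius_gt0 gamma; have r2 := sqr_radius gamma.
apply: (mulIf (lt0r_neq0 r0)); rewrite -expr2 r2; field; exact: lt0r_neq0.
Qed.

Lemma coproj_eq0 gamma a : coproj gamma a = 0 ->
  exists k : int, a = alpha2 gamma + k%:~R * pi.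
Proof.
move=> h; have [|k ak] := @sin_eq0_pi R (a - alpha2 gamma).
  rewrite sinB; have [-> ->] := alpha2_cos_sin gamma.
  apply/eqP; rewrite !mulrA -mulrBl mulf_eq0; apply/orP; left.
  by rewrite -oppr_eq0 -h /coproj; apply/eqP; ring.
by exists k; rewrite -ak; ring.
Qed.

(** As muc multiplies B^2 >= 0, the worst case is muc = [muc_crit], where the
    difference of the two sides is mu times
      (1 - 1/r) (p - gamma)^2 + (1/r) (D - r)^2. *)
Lemma density_support_alpha2 mu muc gamma (r := Num.sqrt (gamma ^+ 2 + 4)) p b :
  0 < mu -> muc_crit mu gamma <= muc ->
  density mu muc gamma (alpha2 gamma)
    + 2 * mu * gamma * (1 - 1 / r) * (p - gamma) <= density mu muc p b.
Proof.
move=> mu0; rewrite /muc_crit -/r => hc.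
have r0 : 0 < r := radius_gt0 gamma; have r1 : 1 < r := radius_gt1 gamma.
have r2 : gamma ^+ 2 = r ^+ 2 - 4 by rewrite sqr_radius addrK.
have rn0 := lt0r_neq0 r0.
rewrite !densityE coproj_alpha2 proj_alpha2 -/r.
have B2 : coproj p b ^+ 2 = p ^+ 2 + 4 - proj p b ^+ 2.
  by rewrite -(proj_coproj p b); ring.
rewrite -subr_ge0.
have -> : mu / 2 * (p ^+ 2 + (proj p b - 2) ^+ 2) + muc / 2 * coproj p b ^+ 2 -
  (mu / 2 * (gamma ^+ 2 + (r - 2) ^+ 2) + muc / 2 * 0 ^+ 2 +
   2 * mu * gamma * (1 - 1 / r) * (p - gamma)) =
  mu * ((1 - r^-1) * (p - gamma) ^+ 2) + mu * (r^-1 * (proj p b - r) ^+ 2)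
   + (muc - mu * (1 - 2 / r)) / 2 * coproj p b ^+ 2.
  by rewrite B2; field: r2; exact: rn0.
have ri : 0 <= 1 - r^-1 by rewrite subr_ge0 invf_le1// ltW.
apply: addr_ge0; first apply: addr_ge0.
- by apply: mulr_ge0; [exact: ltW|exact: mulr_ge0 (sqr_ge0 _)].
- apply: mulr_ge0; first exact: ltW.
  by apply: mulr_ge0 (sqr_ge0 _); rewrite invr_ge0 ltW.
- by apply: mulr_ge0 (sqr_ge0 _); rewrite divr_ge0// subr_ge0.
Qed.

(** Eliminating B turns the density into a quadratic polynomial in p and D
    without mixed term, convex in both, whose vertex in D is the root of the
    second factor. *)
Lemma density_support_alpha1 mu muc gamma a p b :
  0 <= mu + muc -> muc < mu -> (mu - muc) * proj gamma a = 2 * mu ->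
  density mu muc gamma a + (mu + muc) * gamma * (p - gamma)
    <= density mu muc p b.
Proof.
move=> m0 hk hD; have k0 : 0 < mu - muc by rewrite subr_gt0.
have E q c : density mu muc q c = (mu + muc) / 2 * q ^+ 2
    + (mu - muc) / 2 * (proj q c - proj gamma a) ^+ 2
    + 2 * (mu + muc) - (mu - muc) / 2 * proj gamma a ^+ 2.
  rewrite densityE.
  have -> : coproj q c ^+ 2 = q ^+ 2 + 4 - proj q c ^+ 2.
    by rewrite -(proj_coproj q c); ring.
  have hD' : mu * proj gamma a = 2 * mu + muc * proj gamma a.
    by rewrite -hD; ring.
  by field: hD'.
rewrite -subr_ge0 !E.
rewrite (_ : _ - _ = (mu + muc) / 2 * (p - gamma) ^+ 2
   + (mu - muc) / 2 * (proj p b - proj gamma a) ^+ 2); last by field.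
by rewrite addr_ge0// mulr_ge0 ?sqr_ge0// divr_ge0// ltW.
Qed.

End Density.

(** * Roots of the second Euler-Lagrange factor *)

Section SecondFactor.
Context {R : realType}.
Implicit Types mu muc gamma a : R.

Lemma second_factorE mu muc gamma a :
  (mu - muc) * (sin a * gamma - 4 * sin (a / 2) ^+ 2) - 2 * muc =
  (mu - muc) * proj gamma a - 2 * mu.
Proof. by rewrite half_angle /proj; ring. Qed.

Lemma fconst_sqr mu muc gamma :
  4 * mu ^+ 2 <= (gamma ^+ 2 + 4) * (mu - muc) ^+ 2 ->
  fconst mu muc gamma ^+ 2 = (gamma ^+ 2 + 4) * (mu - muc) ^+ 2 - 4 * mu ^+ 2.
Proof. by move=> h; rewrite sqr_sqrtr// subr_ge0. Qed.

Lemma cos_proj gamma a :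
  cos a = (2 * proj gamma a + gamma * coproj gamma a) / (gamma ^+ 2 + 4).
Proof. by rewrite /proj /coproj; field; rewrite gt_eqF// ltr_wpDl// sqr_ge0. Qed.

Lemma sin_proj gamma a :
  sin a = (gamma * proj gamma a - 2 * coproj gamma a) / (gamma ^+ 2 + 4).
Proof. by rewrite /proj /coproj; field; rewrite gt_eqF// ltr_wpDl// sqr_ge0. Qed.

Lemma proj_coproj_inj gamma a b : proj gamma a = proj gamma b ->
  coproj gamma a = coproj gamma b -> exists k : int, a = b + k%:~R * (2 * pi).
Proof.
move=> hp hc; apply: cos_sin_inj.
  by rewrite (cos_proj gamma a) hp hc -cos_proj.
by rewrite (sin_proj gamma a) hp hc -sin_proj.
Qed.

(** Once D is known, B is known up to sign from D^2 + B^2 = gamma^2 + 4; the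
    radicand of f is ((mu - muc) B)^2. *)
Lemma second_factor_roots mu muc gamma a :
  (mu - muc) * proj gamma a = 2 * mu ->
  4 * mu ^+ 2 <= (gamma ^+ 2 + 4) * (mu - muc) ^+ 2 /\
  ((mu - muc) * coproj gamma a = fconst mu muc gamma \/
   (mu - muc) * coproj gamma a = - fconst mu muc gamma).
Proof.
move=> h.
have E : ((mu - muc) * coproj gamma a) ^+ 2 =
    (gamma ^+ 2 + 4) * (mu - muc) ^+ 2 - 4 * mu ^+ 2.
  rewrite -(proj_coproj gamma a) -[4 * _]/(4 * _).
  rewrite (_ : 4 * mu ^+ 2 = (2 * mu) ^+ 2); last by ring.
  by rewrite -h; ring.
have c : 4 * mu ^+ 2 <= (gamma ^+ 2 + 4) * (mu - muc) ^+ 2.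
  by rewrite -subr_ge0 -E sqr_ge0.
split => //; move: E; rewrite -fconst_sqr// => /eqP; rewrite eqf_sqr.
by case/orP => /eqP ->; [left|right].
Qed.

(** Links the sign of the radicand of f to the critical values
    mu (1 - 2/r) and mu (1 + 2/r) of muc. *)
Lemma radius_le_cond mu k gamma (r := Num.sqrt (gamma ^+ 2 + 4)) : 0 < mu ->
  (4 * mu ^+ 2 <= (gamma ^+ 2 + 4) * k ^+ 2) = (mu * (2 / r) <= `|k|).
Proof.
move=> mu0; have r0 : 0 < r := radius_gt0 gamma.
rewrite [in RHS]mulrA ler_pdivrMr//.
have -> : (mu * 2 <= `|k| * r) = ((mu * 2) ^+ 2 <= (`|k| * r) ^+ 2).
  by rewrite ler_pXn2r// nnegrE mulr_ge0// ltW.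
rewrite !exprMn real_normK ?num_real// sqr_radius.
rewrite (_ : mu ^+ 2 * 2 ^+ 2 = 4 * mu ^+ 2); last by ring.
by rewrite [k ^+ 2 * _]mulrC.
Qed.

Lemma alpha1_existE mu muc gamma : 0 < mu -> mu != muc ->
  4 * mu != gamma * fconst mu muc gamma ->
  4 * mu ^+ 2 <= (gamma ^+ 2 + 4) * (mu - muc) ^+ 2 -> alpha1_exist mu muc gamma.
Proof.
move=> mu0 mm hd; rewrite radius_le_cond// => h; split => //.
case: (ltgtP muc mu) mm h => [hk|hk|->]; last by [].
  rewrite ger0_norm ?subr_ge0 ?(ltW hk)// => _ h; left; split => //.
  by rewrite /muc_crit; lra.
by rewrite ltr0_norm ?subr_lt0// => _ h; right; lra.
Qed.

Lemma alpha1_exist_cond mu muc gamma : 0 < mu -> alpha1_exist mu muc gamma ->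
  mu - muc != 0 /\ 4 * mu ^+ 2 <= (gamma ^+ 2 + 4) * (mu - muc) ^+ 2.
Proof.
move=> mu0 [_ h]; have r0 := radius_gt0 gamma.
have c0 : 0 < mu * (2 / Num.sqrt (gamma ^+ 2 + 4)) by rewrite mulr_gt0// divr_gt0.
have {}h : mu * (2 / Num.sqrt (gamma ^+ 2 + 4)) <= `|mu - muc|.
  case: h => [[h1 h2]|h].
    by rewrite ger0_norm ?subr_ge0 ?(ltW h1)//; move: h2; rewrite /muc_crit; lra.
  by rewrite distrC (le_trans _ (ler_norm _))//; lra.
split; last by rewrite radius_le_cond.
by rewrite -normr_gt0 (lt_le_trans c0).
Qed.

(** The Pythagorean relation that feeds [arctan_branch_cos_sin] for alpha1m. *)
Lemma branchm_norm mu muc gamma (f := fconst mu muc gamma) :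
  4 * mu ^+ 2 <= (gamma ^+ 2 + 4) * (mu - muc) ^+ 2 ->
  ((mu - muc) * (gamma ^+ 2 + 4) / 2) ^+ 2 =
  (gamma * mu - f) ^+ 2 + (2 * mu + gamma / 2 * f) ^+ 2.
Proof. by move=> /fconst_sqr; rewrite -/f => fE; field: fE. Qed.

Lemma branchp_norm mu muc gamma (f := fconst mu muc gamma) :
  4 * mu ^+ 2 <= (gamma ^+ 2 + 4) * (mu - muc) ^+ 2 ->
  ((mu - muc) * (gamma ^+ 2 + 4) / 2) ^+ 2 =
  (gamma * mu + f) ^+ 2 + (2 * mu - gamma / 2 * f) ^+ 2.
Proof. by move=> /fconst_sqr; rewrite -/f => fE; field: fE. Qed.

Lemma branch_sign mu muc gamma : mu - muc != 0 ->
  0 < (mu - muc) * ((mu - muc) * (gamma ^+ 2 + 4) / 2).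
Proof.
move=> k0; rewrite !mulrA -expr2 divr_gt0// mulr_gt0//.
  by rewrite lt_def sqr_ge0 sqrf_eq0 k0.
by rewrite ltr_wpDl// sqr_ge0.
Qed.

Lemma alpha1m_proj mu muc gamma : 0 < mu -> 0 < gamma -> mu - muc != 0 ->
  4 * mu ^+ 2 <= (gamma ^+ 2 + 4) * (mu - muc) ^+ 2 ->
  (mu - muc) * proj gamma (alpha1m mu muc gamma) = 2 * mu /\
  (mu - muc) * coproj gamma (alpha1m mu muc gamma) = fconst mu muc gamma.
Proof.
move=> mu0 g0 k0 h; have g4 : gamma ^+ 2 + 4 != 0.
  by rewrite gt_eqF// ltr_wpDl// sqr_ge0.
have d0 : 2 * mu + gamma / 2 * fconst mu muc gamma != 0.
  rewrite gt_eqF// ltr_wpDr ?mulr_gt0// mulr_ge0 ?sqrtr_ge0// divr_ge0//.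
  exact: ltW.
have [] := arctan_branch_cos_sin d0 (branchm_norm h) (branch_sign gamma k0).
rewrite -/(alpha1m mu muc gamma) /proj /coproj => -> ->.
by split; field; rewrite g4 k0.
Qed.

Lemma alpha1p_proj mu muc gamma : mu - muc != 0 ->
  4 * mu != gamma * fconst mu muc gamma ->
  4 * mu ^+ 2 <= (gamma ^+ 2 + 4) * (mu - muc) ^+ 2 ->
  (mu - muc) * proj gamma (alpha1p mu muc gamma) = 2 * mu /\
  (mu - muc) * coproj gamma (alpha1p mu muc gamma) = - fconst mu muc gamma.
Proof.
move=> k0 hd h; have g4 : gamma ^+ 2 + 4 != 0.
  by rewrite gt_eqF// ltr_wpDl// sqr_ge0.
have d0 : 2 * mu - gamma / 2 * fconst mu muc gamma != 0.
  by apply: contraNneq hd => e; apply/eqP; lra.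
have [] := arctan_branch_cos_sin d0 (branchp_norm h) (branch_sign gamma k0).
rewrite -/(alpha1p mu muc gamma) /proj /coproj => -> ->.
by split; field; rewrite g4 k0.
Qed.

(** The equation [eta] a = gamma says that gamma sin a + 2 cos a = 2, whose
    solutions are a = 0 and twice the arctangent of gamma/2 modulo 2 pi; a
    nonzero sine excludes the first. *)
Lemma alpha3_proj gamma : 0 < gamma ->
  proj gamma (alpha3 gamma) = 2 /\ coproj gamma (alpha3 gamma) = - gamma.
Proof.
move=> g0.
have : exists a : R, (a \in `]- pi, pi[) /\ Defs.eta a = gamma.
  exists (alpha2 gamma *+ 2); split.
    have := atan_gtNpi2 (gamma / 2); have := atan_ltpi2 (gamma / 2).
    by rewrite -/(alpha2 gamma) in_itv/=; move=> *; apply/andP; split; lra.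
  have r0 := lt0r_neq0 (radius_gt0 gamma); have r2 := sqr_radius gamma.
  rewrite /Defs.eta half_angle cos_mulr2n sin_mulr2n.
  have [-> ->] := alpha2_cos_sin gamma.
  have -> : 2 - 2 * ((2 / Num.sqrt (gamma ^+ 2 + 4)) ^+ 2 *+ 2 - 1) =
     4 * gamma ^+ 2 / Num.sqrt (gamma ^+ 2 + 4) ^+ 2.
    rewrite (_ : 4 * gamma ^+ 2 = 4 * Num.sqrt (gamma ^+ 2 + 4) ^+ 2 - 16).
      by field.
    by rewrite r2; ring.
  by field; rewrite r0 gt_eqF.
move=> /getPex [_]; rewrite -/(alpha3 gamma) /Defs.eta half_angle.
set a := alpha3 gamma => h.
have s0 : sin a != 0 by apply: contraTneq g0 => s0; rewrite -h s0 invr0 mulr0 ltxx.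
have D : proj gamma a = 2 by rewrite /proj -h divfK//; ring.
split => //.
have := proj_coproj gamma a; rewrite D => E.
have : coproj gamma a ^+ 2 = gamma ^+ 2 by apply: (@addrI _ (2 ^+ 2)); rewrite E; ring.
move=> /eqP; rewrite eqf_sqr => /orP[|] /eqP// c.
by move: s0; rewrite (sin_proj gamma a) c D (mulrC gamma) subrr mul0r eqxx.
Qed.

Lemma fconst_muc0 mu gamma : 0 < mu -> 0 < gamma -> fconst mu 0 gamma = gamma * mu.
Proof.
move=> mu0 g0; rewrite /fconst subr0.
rewrite (_ : _ - _ = (gamma * mu) ^+ 2); last by ring.
by rewrite sqrtr_sqr ger0_norm// mulr_ge0// ltW.
Qed.

Lemma alpha1m_muc0 mu gamma : 0 < mu -> 0 < gamma -> alpha1m mu 0 gamma = 0.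
Proof.
move=> mu0 g0; rewrite /alpha1m fconst_muc0// subrr /arctan_branch mul0r atan0.
rewrite add0r ltNge subr0 mulr_ge0 ?ltW//.
by rewrite ltr_wpDr ?mulr_gt0// mulr_ge0 ?mulr_ge0 ?divr_ge0// ltW.
Qed.

End SecondFactor.

(** * Critical points and minimizers above the homogeneous state *)

Section EulerLagrange.
Context {R : realType}.
Local Notation leb := (@lebesgue_measure R).
Local Notation C01 f :=
  {within (`[0, 1]%classic : set R), continuous (f : R -> R)}.
Implicit Types (mu muc gamma : R) (p a b u : R -> R).

Lemma C01_sin_comp a : C01 a -> C01 (fun x => sin (a x)).
Proof. by move=> ca; apply: C01_comp ca _; exact: continuous_sin. Qed.

Lemma C01_cos_comp a : C01 a -> C01 (fun x => cos (a x)).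
Proof. by move=> ca; apply: C01_comp ca _; exact: continuous_cos. Qed.

Lemma C01_stretch a p : C01 a -> C01 p ->
  C01 (fun x => p x ^+ 2 + (sin (a x) * p x - 4 * sin (a x / 2) ^+ 2) ^+ 2).
Proof.
move=> ca cp; apply: C01D; first exact: C01X.
apply: C01X; apply: C01B.
  by apply: C01M => //; exact: C01_sin_comp.
apply: C01M; first exact: C01_cst.
apply: C01X; apply: C01_sin_comp; apply: C01M => //; exact: C01_cst.
Qed.

Lemma C01_shear a p : C01 a -> C01 p ->
  C01 (fun x => (cos (a x) * p x - 2 * sin (a x)) ^+ 2).
Proof.
move=> ca cp; apply: C01X; apply: C01B.
  by apply: C01M => //; exact: C01_cos_comp.
by apply: C01M; [exact: C01_cst|exact: C01_sin_comp].
Qed.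

Lemma C01_density mu muc p a : C01 p -> C01 a ->
  C01 (fun x => density mu muc (p x) (a x)).
Proof.
move=> cp ca; apply: C01D; (apply: C01M; first exact: C01_cst).
  exact: C01_stretch.
exact: C01_shear.
Qed.

Lemma energy_density mu muc p a : C01 p -> C01 a ->
  energy mu muc p a = \int[leb]_(x in `]0, 1[) density mu muc (p x) (a x).
Proof.
move=> cp ca; rewrite /density RintegralD//.
- rewrite !RintegralZl//; first exact: C01_integrable (C01_shear ca cp).
  exact: C01_integrable (C01_stretch ca cp).
- by apply: C01_integrable; apply: C01M (C01_stretch ca cp); exact: C01_cst.
- by apply: C01_integrable; apply: C01M (C01_shear ca cp); exact: C01_cst.
Qed.

(** The affine bound integrates to its value at p = gamma, because u' has mean
    gamma for every competitor. *)
Lemma local_minimizer_of_support mu muc gamma (alpha s : R) :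
  (forall p b : R, density mu muc gamma alpha + s * (p - gamma)
     <= density mu muc p b) ->
  is_local_minimizer mu muc gamma (ubar gamma) (cst alpha).
Proof.
move=> supp; exists (cst gamma), (cst 0), (cst 0); split.
- exact: in_X_ubar.
- exact: W12_cst.
exists 1 => // v dv ddv b db Xv [cb _ _] _ _.
have [[_ [cdv _ _]] _ _] := Xv.
rewrite !energy_density//; try exact: C01_cst.
rewrite /cst Rintegral01_cst.
have cl : C01 (fun x => density mu muc gamma alpha + s * (dv x - gamma)).
  apply: C01D; first exact: C01_cst.
  apply: C01M; first exact: C01_cst.
  by apply: C01B => //; exact: C01_cst.
have -> : density mu muc gamma alpha =
    \int[leb]_(x in `]0, 1[) (density mu muc gamma alpha + s * (dv x - gamma)).
  have cB : C01 (fun x => dv x - gamma) by apply: C01B => //; exact: C01_cst.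
  rewrite RintegralD//; first last.
  - by apply: C01_integrable; apply: C01M => //; exact: C01_cst.
  - by apply: C01_integrable; exact: C01_cst.
  rewrite RintegralZl//; last exact: C01_integrable.
  rewrite RintegralB//; first last.
  - by apply: C01_integrable; exact: C01_cst.
  - exact: C01_integrable.
  by rewrite (in_X_Rintegral Xv) !Rintegral01_cst subrr mulr0 addr0.
apply: le_Rintegral => //; first exact: C01_integrable.
by apply: C01_integrable; exact: C01_density.
Qed.

Lemma euler_lagrange_cst mu muc gamma (alpha : R) :
  coproj gamma alpha * ((mu - muc) * proj gamma alpha - 2 * mu) = 0 ->
  euler_lagrange mu muc (ubar gamma) (cst alpha).
Proof.
move=> h; exists (cst gamma), (cst 0), (cst 0); split.
- exact: W22_ubar.
- exact: W12_cst.
apply/aeW => x _; rewrite /cst !mulr0 addr0; split => //.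
by rewrite second_factorE -h /coproj (mulrC gamma).
Qed.

Lemma euler_lagrange_ubar mu muc gamma a :
  euler_lagrange mu muc (ubar gamma) a ->
  C01 a /\ forall x, x \in `[0, 1] ->
    coproj gamma (a x) * ((mu - muc) * proj gamma (a x) - 2 * mu) = 0.
Proof.
move=> [du [ddu [da [Wu [ca _ _] EL]]]]; split => //.
have ce := W22_ubar_unique Wu.
apply: (@C01_ae_eq0 R
  (fun x => coproj gamma (a x) * ((mu - muc) * proj gamma (a x) - 2 * mu))).
  have cs := C01_sin_comp ca; have cc := C01_cos_comp ca.
  apply: C01M.
    by apply: C01B; apply: C01M => //; exact: C01_cst.
  apply: C01B; last exact: C01_cst.
  apply: C01M; first exact: C01_cst.
  by apply: C01D; apply: C01M => //; exact: C01_cst.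
have [N [mN N0 sN]] := EL; exists N; split => // x /= nx; apply: sN => /= h.
apply: nx => x01; have [_] := h x01.
by rewrite second_factorE /coproj (ce _ x01) (mulrC gamma) => <-.
Qed.

(** Otherwise the image contains a nondegenerate interval, which is not
    countable. *)
Lemma C01_countable_cst a (S : set R) : C01 a -> countable S ->
  (forall x, x \in `[0, 1] -> S (a x)) -> const_on01 a (a 0).
Proof.
move=> ca cS aS x x01; apply: contrapT => /eqP ax.
pose m := Num.min (a 0) (a x); pose M := Num.max (a 0) (a x).
have mM : m < M by rewrite /m /M; move: ax; case: (ltgtP (a 0) (a x)).
pose A : set R := `[m, M]%classic.
have AS : A `<=` S.
  move=> v; rewrite /A/= in_itv/= => vmM.
  have := x01; rewrite in_itv/= => /andP[x0 x1].
  have [|c] := @IVT R a 0 x v x0 _ vmM.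
    by apply: continuous_subspaceW ca; apply: subset_itvl; rewrite bnd_simp.
  rewrite in_itv/= => /andP[c0 cx] <-; apply: aS.
  by rewrite in_itv/= c0 (le_trans cx).
have : leb A = 0%E.
  by apply: countable_lebesgue_measure0; exact: sub_countable (subset_card_le AS) cS.
rewrite /A lebesgue_measure_itv/= lte_fin mM -EFinD => -[] /eqP.
by rewrite subr_eq0 gt_eqF.
Qed.

Lemma countable_progression (c d : R) :
  countable [set x | exists k : int, x = c + k%:~R * d].
Proof.
have -> : [set x | exists k : int, x = c + k%:~R * d] =
    (fun k : int => c + k%:~R * d) @` setT.
  by apply/seteqP; split => x [k]; [move=> ->; exists k|move=> _ <-; exists k].
exact: sub_countable (card_image_le _ _) _.
Qed.

Lemma countable_setU (A B : set R) :
  countable A -> countable B -> countable (A `|` B).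
Proof.
move=> cA cB.
have -> : A `|` B = \bigcup_(i in [set: bool]) (if i then A else B).
  apply/seteqP; split => x /=; first by case=> h; [exists true|exists false].
  by case=> -[] _ h; [left|right].
by apply: bigcup_countable => // -[].
Qed.

End EulerLagrange.

(** * Cutoffs on an interval *)

Section Monotonicity.
Context {R : realType}.
Local Notation leb := (@lebesgue_measure R).
Local Notation C01 f :=
  {within (`[0, 1]%classic : set R), continuous (f : R -> R)}.
Implicit Types (mu muc gamma c d x y : R) (p a b u : R -> R).

Lemma bounded_convergence01 (f_ : nat -> R -> R) (f : R -> R) (M : R) :
  (forall n, C01 (f_ n)) ->
  (forall n x, x \in `]0, 1[ -> `|f_ n x| <= M) ->
  (forall x, x \in `]0, 1[ -> f_ n x @[n --> \oo] --> f x) ->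
  leb.-integrable (`]0, 1[ : set R) (EFin \o f) /\
  \int[leb]_(x in `]0, 1[) f_ n x @[n --> \oo] --> \int[leb]_(x in `]0, 1[) f x.
Proof.
move=> cf fM fcv; pose A : set R := `]0, 1[%classic.
have mA : measurable (A : set (measurableTypeR R)) by exact: measurable_itv.
have mf n : measurable_fun A (EFin \o f_ n).
  by apply/measurable_EFinP; exact: C01_measurable.
have fcvE x : A x -> (EFin \o f_ n) x @[n --> \oo] --> (EFin \o f) x.
  by move=> /fcv h; apply: cvg_EFin => //; exact: nearW.
have iM : leb.-integrable A (EFin \o cst M) by apply: C01_integrable; exact: C01_cst.
have mfl : measurable_fun A (EFin \o f) by exact: emeasurable_fun_cvg mf fcvE.
have [||iF _ cvF] := @dominated_convergence _ _ _ leb A mA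
  (fun n => EFin \o f_ n) (EFin \o f) (EFin \o cst M) mf mfl _ iM _.
- by apply/aeW => x Ax; exact: fcvE.
- by apply/aeW => x n Ax; rewrite /= lee_fin; exact: fM.
split => //; apply: fine_cvg.
by rewrite fineK//; exact: integrable_fin_num iF.
Qed.

Lemma weak_FTC_itv u p x y : W12 u p -> C01 p -> 0 <= x -> x <= y -> y <= 1 ->
  \int[leb]_(t in `]x, y[) p t = u y - u x.
Proof.
move=> [cu _ up] cp x0 xy y1.
rewrite (weak_FTC cu cp up (x := x)); last by rewrite in_itv/= x0 (le_trans xy).
rewrite (weak_FTC cu cp up (x := y)); last by rewrite in_itv/= y1 (le_trans x0).
have ip := C01_integrable_cc cp.
rewrite (_ : _ - _ = primitive01 p y - primitive01 p x); last by ring.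
rewrite Rintegral_itvB//.
- rewrite Rintegral_itv_bndo_bndc//; apply: integrableS ip => //.
  by apply: subset_itv; rewrite bnd_simp// ltW.
- by apply: integrableS ip => //; apply: subset_itvl; rewrite bnd_simp.
Qed.

(** For c <= d, a C^1 function that is positive exactly on ]c, d[. *)
Definition hump c d x : R := relu2 ((x - c) * (d - x)).

(** C^1 approximations, as n grows, of the indicator of the complement of
    ]c, d[; equal to 1 outside ]c, d[ for every n, so that boundary values are
    kept. *)
Definition cutoff c d (n : nat) x : R := expR (- (n%:R * hump c d x)).

Definition cutoff_lim c d x : R := if x \in `]c, d[ then 0 else 1.

Lemma hump_ge0 c d x : 0 <= hump c d x.
Proof. exact: sqr_ge0. Qed.

Lemma hump_gt0 c d x : x \in `]c, d[ -> 0 < hump c d x.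
Proof.
rewrite in_itv/= => /andP[cx xd]; rewrite /hump /relu2 exprn_gt0// lt_max.
by rewrite mulr_gt0 ?orbT// subr_gt0.
Qed.

Lemma hump_eq0 c d x : c <= d -> x \notin `]c, d[ -> hump c d x = 0.
Proof.
move=> cd; rewrite in_itv/= negb_and -!leNgt => h.
rewrite /hump /relu2 max_l ?expr0n//.
by case/orP: h => h; [rewrite mulr_le0_ge0|rewrite mulr_ge0_le0]; lra.
Qed.

Lemma hump_le1 c d x : 0 <= c -> d <= 1 -> x \in `[0, 1] -> c <= d ->
  hump c d x <= 1.
Proof.
move=> c0 d1; rewrite in_itv/= => /andP[x0 x1] cd.
have [xcd|xcd] := boolP (x \in `]c, d[); last by rewrite hump_eq0.
move: xcd; rewrite in_itv/= => /andP[cx xd].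
rewrite /hump /relu2 max_r; last by rewrite mulr_ge0; lra.
by rewrite exprn_ile1 ?mulr_ge0 ?mulr_ile1//; lra.
Qed.

Definition dhump c d x : R :=
  2 * Num.max 0 ((x - c) * (d - x)) * (c + d - 2 * x).

Lemma hump_is_derive c d x : is_derive x (1 : R) (hump c d) (dhump c d x).
Proof.
have h : is_derive x (1 : R) (fun x => (x - c) * (d - x)) (c + d - 2 * x).
  have h1 : is_derive x (1 : R) (fun x => x - c) 1.
    have := is_deriveB (is_derive_id x (1 : R)) (is_derive_cst c x (1 : R)).
    by rewrite subr0.
  have h2 : is_derive x (1 : R) (fun x => d - x) (- 1).
    have := is_deriveB (is_derive_cst d x (1 : R)) (is_derive_id x (1 : R)).
    by rewrite sub0r.
  have := is_deriveM_fun h1 h2.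
  by rewrite (_ : (x - c) * -1 + (d - x) * 1 = c + d - 2 * x); last by ring.
exact: (@is_derive1_comp R relu2 _ x _ _ (relu2_is_derive _) h).
Qed.

Lemma dhump_continuous c d : continuous (dhump c d).
Proof.
have cq : continuous (fun x : R => (x - c) * (d - x)).
  move=> x; apply: cvgM; apply: cvgB; try exact: cvg_id; exact: cvg_cst.
move=> x; apply: cvgM.
  apply: cvgM; first exact: cvg_cst.
  by apply: (@continuous_comp _ _ _ (fun x : R => (x - c) * (d - x)));
    [exact: cq|exact: max0_continuous].
apply: cvgB; first exact: cvg_cst.
by apply: cvgM; [exact: cvg_cst|exact: cvg_id].
Qed.

Lemma hump_continuous c d : continuous (hump c d).
Proof.
move=> x; apply/differentiable_continuous/derivable1_diffP.
by have [] := hump_is_derive c d x.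
Qed.

Definition dcutoff c d n x : R := cutoff c d n x * (- (n%:R * dhump c d x)).

Lemma cutoff_is_derive c d n x :
  is_derive x (1 : R) (cutoff c d n) (dcutoff c d n x).
Proof.
have h : is_derive x (1 : R) (fun x => - (n%:R * hump c d x))
    (- (n%:R * dhump c d x)).
  have := is_deriveM_fun (is_derive_cst (n%:R : R) x (1 : R)) (hump_is_derive c d x).
  by rewrite mulr0 addr0 => h; exact: is_deriveN.
exact: (@is_derive1_comp R expR _ x _ _ (is_derive_expR _) h).
Qed.

Lemma cutoff_continuous c d n : continuous (cutoff c d n).
Proof.
move=> x; apply/differentiable_continuous/derivable1_diffP.
by have [] := cutoff_is_derive c d n x.
Qed.

Lemma dcutoff_continuous c d n : continuous (dcutoff c d n).
Proof.
move=> x; apply: cvgM; first exact: cutoff_continuous.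
apply: cvgN; apply: cvgM; first exact: cvg_cst.
exact: dhump_continuous.
Qed.

Lemma cutoff_ge0 c d n x : 0 <= cutoff c d n x.
Proof. exact: expR_ge0. Qed.

Lemma cutoff_le1 c d n x : cutoff c d n x <= 1.
Proof. by rewrite /cutoff -expR0 ler_expR oppr_le0 mulr_ge0// hump_ge0. Qed.

Lemma cutoff_eq1 c d n x : c <= d -> x \notin `]c, d[ -> cutoff c d n x = 1.
Proof. by move=> cd h; rewrite /cutoff hump_eq0// mulr0 oppr0 expR0. Qed.

Lemma cutoff_cvg c d x : c <= d ->
  cutoff c d n x @[n --> \oo] --> cutoff_lim c d x.
Proof.
move=> cd; rewrite /cutoff_lim; case: ifPn => xcd; last first.
  by under eq_fun do rewrite cutoff_eq1//; exact: cvg_cst.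
have b0 := hump_gt0 xcd.
have -> : (fun n => cutoff c d n x) = (fun n => (expR (- hump c d x)) ^+ n).
  by apply/funext => n; rewrite /cutoff -mulrN mulrC -expRM_natl mulrC.
apply: cvg_expr; rewrite ger0_norm ?expR_ge0//.
by rewrite -expR0 ltr_expR oppr_lt0.
Qed.

Lemma cvg_density mu muc (p_ a_ : nat -> R) (p a : R) :
  p_ n @[n --> \oo] --> p -> a_ n @[n --> \oo] --> a ->
  density mu muc (p_ n) (a_ n) @[n --> \oo] --> density mu muc p a.
Proof.
move=> cp ca.
have cs : sin (a_ n) @[n --> \oo] --> sin a.
  by apply: continuous_cvg => //; exact: continuous_sin.
have cc : cos (a_ n) @[n --> \oo] --> cos a.
  by apply: continuous_cvg => //; exact: continuous_cos.
have sqr (f : nat -> R) (l : R) : f n @[n --> \oo] --> l ->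
    f n ^+ 2 @[n --> \oo] --> l ^+ 2.
  by move=> h; under eq_fun do rewrite expr2; rewrite expr2; exact: cvgM.
rewrite densityE; under eq_fun do rewrite densityE.
apply: cvgD; (apply: cvgM; first exact: cvg_cst).
  apply: cvgD; apply: sqr => //; apply: cvgB; last exact: cvg_cst.
  by apply: cvgD; apply: cvgM => //; exact: cvg_cst.
by apply: sqr; apply: cvgB; apply: cvgM => //; exact: cvg_cst.
Qed.

Lemma density_ge mu muc (p a : R) : 0 <= mu -> 0 <= muc ->
  mu / 2 * p ^+ 2 <= density mu muc p a.
Proof.
move=> m0 mc0; rewrite densityE mulrDr -addrA lerDl.
by rewrite addr_ge0// mulr_ge0 ?sqr_ge0// divr_ge0.
Qed.

Lemma density_le mu muc (P p a : R) : 0 <= mu -> 0 <= muc -> `|p| <= P ->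
  `|density mu muc p a| <= mu / 2 * (P ^+ 2 + (P + 4) ^+ 2) + muc / 2 * (P + 2) ^+ 2.
Proof.
move=> m0 mc0 pP.
have P0 : 0 <= P := le_trans (normr_ge0 _) pP.
have sq (z Z : R) : `|z| <= Z -> z ^+ 2 <= Z ^+ 2.
  move=> h; rewrite -[leLHS]real_normK ?num_real// lerXn2r// nnegrE//.
  exact: le_trans h.
have s1 : `|p * sin a| <= P by rewrite normrM -[P]mulr1 ler_pM// sin_max.
have c1 : `|p * cos a| <= P by rewrite normrM -[P]mulr1 ler_pM// cos_max.
have s2 := sin_max a; have c2 := cos_max a.
rewrite ger0_norm; last first.
  by apply: le_trans (density_ge _ _ m0 mc0); rewrite mulr_ge0 ?sqr_ge0// divr_ge0.
rewrite densityE lerD// ler_wpM2l ?divr_ge0//.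
- rewrite lerD//; first exact: sq.
  apply: sq; rewrite /proj; move: s1 c2; rewrite !ler_norml => /andP[? ?] /andP[? ?].
  by apply/andP; split; lra.
- apply: sq; rewrite /coproj; move: c1 s2; rewrite !ler_norml => /andP[? ?] /andP[? ?].
  by apply/andP; split; lra.
Qed.

End Monotonicity.

(** * Minimizers have no excursions *)

Section Excursion.
Context {R : realType}.
Local Notation leb := (@lebesgue_measure R).
Local Notation C01 f :=
  {within (`[0, 1]%classic : set R), continuous (f : R -> R)}.
Implicit Types (mu muc gamma c d x y : R) (p a b u : R -> R).

Lemma C01_cutoff c d n : C01 (cutoff c d n).
Proof. exact/C01_of_continuous/cutoff_continuous. Qed.

Lemma integral_cutoffC_cvg c d p : 0 <= c -> c <= d -> d <= 1 -> C01 p ->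
  \int[leb]_(x in `]0, 1[) ((1 - cutoff c d n x) * p x) @[n --> \oo] -->
  \int[leb]_(x in `]c, d[) p x.
Proof.
move=> c0 cd d1 cp; have [M M0 pM] := C01_bounded cp.
have [] := @bounded_convergence01 R
  (fun n x => (1 - cutoff c d n x) * p x)
  (fun x => (1 - cutoff_lim c d x) * p x) M.
- move=> n; apply: C01M => //; apply: C01B; first exact: C01_cst.
  exact: C01_cutoff.
- move=> n x /itv01_oo_cc x01; rewrite normrM -[M]mul1r ler_pM// ?pM//.
  by rewrite ger0_norm ?subr_ge0 ?cutoff_le1// gerBl cutoff_ge0.
- move=> x _; apply: cvgM; last exact: cvg_cst.
  by apply: cvgB; [exact: cvg_cst|exact: cutoff_cvg].
move=> _; suff -> : \int[leb]_(x in `]0, 1[) ((1 - cutoff_lim c d x) * p x) =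
  \int[leb]_(x in `]c, d[) p x by [].
have -> : (`]c, d[%classic : set R) = `]0, 1[%classic `&` `]c, d[%classic.
  rewrite setIidr//; apply: subset_itv; rewrite bnd_simp//.
rewrite Rintegral_mkcondr; apply: eq_Rintegral => x _.
rewrite patchE /cutoff_lim mem_setE; case: ifPn => _.
  by rewrite subr0 mul1r.
by rewrite subrr mul0r.
Qed.

Lemma cutoff_W12 c d n f g : W12 f g ->
  W12 (fun x => cutoff c d n x * f x)
      (fun x => cutoff c d n x * g x + dcutoff c d n x * f x).
Proof.
by apply: W12M; [exact: cutoff_is_derive|exact: dcutoff_continuous].
Qed.

Lemma cutoffC_W12 c d n (k : R) :
  W12 (fun x => k * (1 - cutoff c d n x)) (fun x => - (k * dcutoff c d n x)).
Proof.
apply: W12_C1.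
- apply: C01M; first exact: C01_cst.
  by apply: C01B; [exact: C01_cst|exact: C01_cutoff].
- apply: C01_of_continuous => x; apply: cvgN; apply: cvgM; first exact: cvg_cst.
  exact: dcutoff_continuous.
move=> x _; have h := is_deriveB (is_derive_cst (1 : R) x (1 : R)) (cutoff_is_derive c d n x).
have := is_deriveM_fun (is_derive_cst k x (1 : R)) h.
by rewrite mulr0 addr0 sub0r mulrN.
Qed.

(** The competitor multiplies u' and a by the cutoff on an interval over which
    u' has integral 0. The correction k (1 - cutoff) restores the mean of u' and
    disappears in the limit. The limit loses at least mu/2 int_c^d u'^2, which
    must therefore be 0. The boundary conditions enter through the fact that
    they depend on end values only. *)
Lemma excursion_flat (bc : (R -> R) -> (R -> R) -> Prop) mu muc gamma
    u du ddu a da c d :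
  0 < mu -> 0 <= muc ->
  (forall p a q b, q 0 = p 0 -> q 1 = p 1 -> b 0 = a 0 -> b 1 = a 1 ->
     bc p a -> bc q b) ->
  in_X gamma u du ddu -> W12 a da -> bc du a ->
  (forall v dv ddv b db, in_X gamma v dv ddv -> W12 b db -> bc dv b ->
     energy mu muc du a <= energy mu muc dv b) ->
  0 <= c -> c < d -> d <= 1 -> u c = u d ->
  forall x, x \in `]c, d[ -> du x = 0.
Proof.
move=> mu0 muc0 bcE Xu Wa bca emin c0 cd d1 ucd.
have [[Wu Wdu] u0 u1] := Xu.
have cdu : C01 du by case: Wdu.
have ca : C01 a by case: Wa.
have cd' := ltW cd.
have [M M0 duM] := C01_bounded cdu.
pose num n := \int[leb]_(x in `]0, 1[) ((1 - cutoff c d n x) * du x).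
pose den n := \int[leb]_(x in `]0, 1[) ((1 - cutoff c d n x) * 1).
have numcv : num n @[n --> \oo] --> (0 : R).
  have := integral_cutoffC_cvg c0 cd' d1 cdu.
  by rewrite (weak_FTC_itv Wu cdu c0 cd' d1) ucd subrr.
have dencv : den n @[n --> \oo] --> d - c.
  have := integral_cutoffC_cvg c0 cd' d1 (@C01_cst R 1).
  rewrite (@weak_FTC_itv R (ubar 1) (fun=> 1) c d)//; last exact: C01_cst.
    by rewrite /ubar !mul1r.
  by have [] := W22_ubar (1 : R).
(* This choice of k makes the mean of q n equal to that of du whenever
   den n is nonzero, which holds for large n. *)
pose k n := num n / den n.
have kcv : k n @[n --> \oo] --> (0 : R).
  rewrite -(mul0r (d - c)^-1); apply: cvgM => //; apply: cvgV => //.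
  by rewrite subr_eq0 gt_eqF.
pose q n x := cutoff c d n x * du x + k n * (1 - cutoff c d n x).
pose b n x := cutoff c d n x * a x.
have Wq n := W12D (cutoff_W12 c d n Wdu) (cutoffC_W12 c d n (k n)).
have Wb n := cutoff_W12 c d n Wa.
have cq n : C01 (q n) by case: (Wq n).
have cb n : C01 (b n) by case: (Wb n).
have end01 n x : x = 0 \/ x = 1 -> q n x = du x /\ b n x = a x.
  move=> xe; have e : cutoff c d n x = 1.
    apply: cutoff_eq1 => //; rewrite in_itv/= negb_and -!leNgt.
    by case: xe => ->; rewrite ?c0 ?d1 ?orbT.
  by rewrite /q /b e !mul1r subrr mulr0 addr0.
have intq n : den n != 0 -> \int[leb]_(x in `]0, 1[) q n x = gamma.
  move=> dn0; have C1 := @C01_cutoff c d n.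
  have CC : C01 (fun x => 1 - cutoff c d n x) by apply: C01B => //; exact: C01_cst.
  rewrite /q RintegralD//; first last.
  - by apply: C01_integrable; apply: C01M => //; exact: C01_cst.
  - by apply: C01_integrable; exact: C01M.
  rewrite RintegralZl//; last exact: C01_integrable.
  rewrite (_ : \int[leb]_(x in `]0, 1[) (1 - cutoff c d n x) = den n); last first.
    by apply: eq_Rintegral => x _; rewrite mulr1.
  rewrite divfK// /num -RintegralD//; first last.
  - by apply: C01_integrable; exact: C01M.
  - by apply: C01_integrable; exact: C01M.
  rewrite -(in_X_Rintegral Xu); apply: eq_Rintegral => x _; ring.
have Eq n : den n != 0 -> energy mu muc du a <= energy mu muc (q n) (b n).
  move=> dn0; apply: (emin (primitive01 (q n)) _ _ _ _ _ (Wb n)).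
    split; last by rewrite primitive01_1// intq.
      by split; [exact: W12_primitive01|exact: Wq].
    by rewrite primitive01_0.
  have [q0 b0] := end01 n 0 (or_introl erefl).
  have [q1 b1] := end01 n 1 (or_intror erefl).
  exact: bcE bca.
pose ql x := cutoff_lim c d x * du x + 0 * (1 - cutoff_lim c d x).
pose bl x := cutoff_lim c d x * a x.
have [K K0 kK] : exists2 K : R, 0 <= K & forall n, `|k n| <= K.
  have [K [Kr KP]] : bounded_fun k by apply: cvg_seq_bounded; apply/cvg_ex; exists 0.
  exists (`|K| + 1) => [|n]; first by rewrite addr_ge0.
  by apply: KP => //; rewrite (le_lt_trans (ler_norm _))// ltrDl.
have qM n x : x \in `]0, 1[ -> `|q n x| <= M + K.
  move=> /itv01_oo_cc x01; rewrite (le_trans (ler_normD _ _))// lerD//.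
    rewrite normrM -[M]mul1r ler_pM// ?duM//.
    by rewrite ger0_norm ?cutoff_ge0// cutoff_le1.
  rewrite normrM -[K]mulr1 ler_pM// ger0_norm ?subr_ge0 ?cutoff_le1//.
  by rewrite gerBl cutoff_ge0.
have [|||il Ecv] := @bounded_convergence01 R
   (fun n x => density mu muc (q n x) (b n x))
   (fun x => density mu muc (ql x) (bl x))
   (mu / 2 * ((M + K) ^+ 2 + (M + K + 4) ^+ 2) + muc / 2 * (M + K + 2) ^+ 2).
- by move=> n; exact: C01_density.
- by move=> n x x01; apply: density_le => //; [exact: ltW|exact: qM].
- move=> x _; apply: cvg_density.
    apply: cvgD; first by apply: cvgM; [exact: cutoff_cvg|exact: cvg_cst].
    apply: cvgM => //; apply: cvgB; [exact: cvg_cst|exact: cutoff_cvg].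
  by apply: cvgM; [exact: cutoff_cvg|exact: cvg_cst].
(* The hump, at most 1 and supported in ]c, d[, is a continuous stand-in for
   the indicator of ]c, d[ in the lower bound of the energy lost. *)
have cT : C01 (fun x => mu / 2 * (hump c d x * du x ^+ 2)).
  apply: C01M; first exact: C01_cst.
  by apply: C01M; [exact/C01_of_continuous/hump_continuous|exact: C01X].
have le1 : energy mu muc du a <=
    \int[leb]_(x in `]0, 1[) density mu muc (ql x) (bl x).
  apply: (cvgr_to_ge Ecv); near=> n.
  rewrite -energy_density//; apply: Eq; rewrite gt_eqF//; near: n.
  by apply: (cvgr_gt _ dencv); rewrite subr_gt0.
have le2 : \int[leb]_(x in `]0, 1[) density mu muc (ql x) (bl x) <=
    energy mu muc du a - \int[leb]_(x in `]0, 1[) (mu / 2 * (hump c d x * du x ^+ 2)).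
  rewrite energy_density// -RintegralB//; first last.
  - exact: C01_integrable.
  - by apply: C01_integrable; exact: C01_density.
  apply: le_Rintegral => //.
    by apply: C01_integrable; apply: C01B => //; exact: C01_density.
  move=> x /= x01; rewrite /ql /bl /cutoff_lim mul0r addr0; case: ifPn => xcd.
    rewrite !mul0r; have -> : density mu muc 0 0 = 0.
      by rewrite /density mul0r sin0 cos0; ring.
    rewrite subr_ge0; apply: le_trans (density_ge _ _ (ltW mu0) muc0).
    rewrite ler_wpM2l ?divr_ge0 ?(ltW mu0)// -[leRHS]mul1r ler_wpM2r ?sqr_ge0//.
    by apply: hump_le1 => //; exact: itv01_oo_cc.
  by rewrite !mul1r hump_eq0// mul0r mulr0 subr0.
have Tge0 x : 0 <= mu / 2 * (hump c d x * du x ^+ 2).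
  by rewrite mulr_ge0 ?divr_ge0 ?(ltW mu0)// mulr_ge0 ?hump_ge0 ?sqr_ge0.
have T0 : \int[leb]_(x in `]0, 1[) (mu / 2 * (hump c d x * du x ^+ 2)) = 0.
  apply/eqP; rewrite eq_le; apply/andP; split; first by lra.
  exact: Rintegral_ge0.
move=> x xcd; have xI : x \in `[0, 1].
  move: xcd; rewrite !in_itv/= => /andP[cx xd].
  by apply/andP; split; lra.
have := C01_Rintegral_eq0 cT (fun x _ => Tge0 x) T0 xI.
have m0 : 0 < mu / 2 * hump c d x by rewrite mulr_gt0 ?hump_gt0// divr_gt0.
rewrite mulrA => /eqP; rewrite mulf_eq0 (gt_eqF m0) sqrf_eq0.
by move=> /= /eqP.
Unshelve. all: by end_near. Qed.

(** If u y < u x with x < y, the end values 0 and gamma and the intermediate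
    value theorem extend [x, y] to an interval with equal values of u at its
    ends, on which u' = 0 by [excursion_flat]. *)
Lemma minimizer_monotone (bc : (R -> R) -> (R -> R) -> Prop) mu muc gamma u a :
  0 < mu -> 0 <= muc -> 0 < gamma ->
  (forall p a q b, q 0 = p 0 -> q 1 = p 1 -> b 0 = a 0 -> b 1 = a 1 ->
     bc p a -> bc q b) ->
  is_minimizer bc mu muc gamma u a ->
  {in `[0, 1] &, {homo u : x y / x <= y}}.
Proof.
move=> mu0 muc0 g0 bcE [du [ddu [da [Xu Wa bca emin]]]] x y x01 y01 xy.
have [[Wu Wdu] u0 u1] := Xu.
have cu : C01 u by case: Wu.
have cdu : C01 du by case: Wdu.
move: (x01) (y01); rewrite !in_itv/= => /andP[x0 x1] /andP[y0 y1].
rewrite leNgt; apply/negP => uyx.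
(* If u x >= gamma, the level gamma is taken on [0, x] and again at 1;
   otherwise the level u x is taken again between y and 1. *)
have [c [d [c0 cx yd d1 ucd]]] : exists c d,
    [/\ 0 <= c, c <= x, y <= d, d <= 1 & u c = u d].
  have [uxg|uxg] := leP gamma (u x).
    have [||c] := @IVT R u 0 x gamma x0.
    - by apply: continuous_subspaceW cu; apply: subset_itvl; rewrite bnd_simp.
    - have ux0 : 0 <= u x by rewrite (le_trans (ltW g0)).
      by rewrite u0 min_l// max_r// (ltW g0).
    rewrite in_itv/= => /andP[c0 cx] uc; exists c, 1.
    by rewrite uc u1 lexx; split.
  have [||d] := @IVT R u y 1 (u x) y1.
  - by apply: continuous_subspaceW cu; apply: subset_itvr; rewrite bnd_simp.
  - have uyg : u y <= gamma by rewrite ltW// (lt_trans uyx).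
    by rewrite u1 min_l// max_r// !ltW.
  rewrite in_itv/= => /andP[yd d1] ud; exists x, d.
  by rewrite ud lexx; split.
have cd : c < d.
  rewrite lt_neqAle (le_trans cx (le_trans xy yd)) andbT.
  apply: contraTneq uyx => e; rewrite -leNgt.
  have -> : x = y; last by [].
  by apply/eqP; rewrite eq_le xy (le_trans yd)// -e.
have du0 := excursion_flat mu0 muc0 bcE Xu Wa bca emin c0 cd d1 ucd.
have : \int[leb]_(t in `]x, y[) du t = 0.
  rewrite (@eq_Rintegral _ _ _ _ _ (cst 0)).
    by rewrite Rintegral_cst// mul0r.
  move=> t; rewrite inE/= in_itv/= => /andP[xt ty]; apply: du0.
  by rewrite in_itv/= (le_lt_trans cx xt) (lt_le_trans ty yd).
rewrite (weak_FTC_itv Wu cdu x0 xy y1) => /eqP; rewrite subr_eq0 => /eqP e.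
by rewrite e ltxx in uyx.
Qed.

End Excursion.

(** * Constant solutions *)

Section Classification.
Context {R : realType}.
Implicit Types (mu muc gamma : R) (a : R -> R).

Lemma consistent_coupling_ext (p a q b : R -> R) : q 0 = p 0 -> q 1 = p 1 ->
  b 0 = a 0 -> b 1 = a 1 -> consistent_coupling p a -> consistent_coupling q b.
Proof. by move=> q0 q1 b0 b1 [h1 h2 h3 h4]; split; rewrite ?q0 ?q1 ?b0 ?b1. Qed.

Lemma dirichlet_ext aD (p a q b : R -> R) : q 0 = p 0 -> q 1 = p 1 ->
  b 0 = a 0 -> b 1 = a 1 -> dirichlet aD p a -> dirichlet aD q b.
Proof. by move=> _ _ b0 b1 [h1 h2]; split; rewrite ?b0 ?b1. Qed.

(** By [second_factor_roots] there are at most two roots modulo 2 pi. *)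
Lemma proj_level_countable mu muc gamma : 0 < mu ->
  countable [set x | (mu - muc) * proj gamma x = 2 * mu].
Proof.
move=> mu0; set S := [set x | _].
have roots (e : R) : countable [set x | S x /\ (mu - muc) * coproj gamma x = e].
  (* A single solution y determines the others modulo 2 pi. *)
  have [[y [Sy ye]]|none] :=
      pselect (exists y, S y /\ (mu - muc) * coproj gamma y = e); last first.
    rewrite (_ : [set x | _] = set0) // -subset0 => x h.
    by apply: none; exists x.
  apply: sub_countable (countable_progression y (2 * pi)).
  apply: subset_card_le => x [Sx xe].
  have k0 : mu - muc != 0.
    apply: contraTneq mu0 => k0; move: Sy; rewrite /S/= k0 mul0r => e0.
    by rewrite -leNgt; lra.
  apply: (@proj_coproj_inj _ gamma); apply: (mulfI k0).
    by rewrite Sx Sy.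
  by rewrite xe ye.
apply: sub_countable
  (countable_setU (roots (fconst mu muc gamma)) (roots (- fconst mu muc gamma))).
apply: subset_card_le => x Sx.
by have [_ [h|h]] := second_factor_roots Sx; [left|right].
Qed.

Lemma euler_lagrange_const mu muc gamma a : 0 < mu ->
  euler_lagrange mu muc (ubar gamma) a ->
  exists2 alpha : R, const_on01 a alpha &
    (exists k : int, alpha = alpha2 gamma + k%:~R * pi) \/
    (mu - muc) * proj gamma alpha = 2 * mu.
Proof.
move=> mu0 /euler_lagrange_ubar[ca h].
have h' x : x \in `[0, 1] -> coproj gamma (a x) = 0 \/
    (mu - muc) * proj gamma (a x) = 2 * mu.
  move=> /h /eqP; rewrite mulf_eq0 => /orP[/eqP|]; first by left.
  by rewrite subr_eq0 => /eqP; right.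
exists (a 0).
  by apply: (C01_countable_cst ca (countable_setU
    (countable_progression (alpha2 gamma) pi)
    (@proj_level_countable mu muc gamma mu0))) => x /h'[/coproj_eq0|] e; [left|right].
by have [|/coproj_eq0|] := h' 0; [rewrite in_itv/= lexx ler01|left|right].
Qed.

End Classification.

Theorem corollary1 (R : realType) (mu muc gamma : R)
    (hmu : 0 < mu) (hmuc : 0 <= muc) (hgamma : 0 < gamma) :
  (* monotonicity of minimizers, for either kind of boundary conditions *)
  (forall u a : R -> R,
     (is_minimizer consistent_coupling mu muc gamma u a \/
      exists aD : R, is_minimizer (dirichlet aD) mu muc gamma u a) ->
     {in `[0, 1] &, {homo u : x y / x <= y}})
  /\
  (exists a : R -> R, euler_lagrange mu muc (ubar gamma) a)
  /\
  (* (i) *)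
  (mu = muc ->
     [/\ euler_lagrange mu muc (ubar gamma) (cst (alpha2 gamma)),
         (forall a, euler_lagrange mu muc (ubar gamma) a ->
            exists k : int, const_on01 a (alpha2 gamma + k%:~R * pi)) &
         is_local_minimizer mu muc gamma (ubar gamma) (cst (alpha2 gamma))])
  /\
  (* (ii) *)
  (muc = 0 ->
     [/\ alpha1m mu muc gamma = 0,
         [/\ euler_lagrange mu muc (ubar gamma) (cst (alpha1m mu muc gamma)),
             euler_lagrange mu muc (ubar gamma) (cst (alpha2 gamma)) &
             euler_lagrange mu muc (ubar gamma) (cst (alpha3 gamma))],
         (forall a, euler_lagrange mu muc (ubar gamma) a ->
            exists k : int,
              [\/ const_on01 a (alpha1m mu muc gamma + k%:~R * (2 * pi)),
                  const_on01 a (alpha2 gamma + k%:~R * pi) |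
                  const_on01 a (alpha3 gamma + k%:~R * (2 * pi))]),
         is_local_minimizer mu muc gamma (ubar gamma) (cst 0) &
         is_local_minimizer mu muc gamma (ubar gamma) (cst (alpha3 gamma))])
  /\
  (* (iii) *)
  (0 < muc -> mu != muc ->
     [/\ euler_lagrange mu muc (ubar gamma) (cst (alpha2 gamma)),
         (alpha1_exist mu muc gamma ->
            euler_lagrange mu muc (ubar gamma) (cst (alpha1m mu muc gamma)) /\
            euler_lagrange mu muc (ubar gamma) (cst (alpha1p mu muc gamma))),
         (4 * mu != gamma * fconst mu muc gamma ->
          forall a, euler_lagrange mu muc (ubar gamma) a ->
            exists k : int,
              const_on01 a (alpha2 gamma + k%:~R * pi) \/
              (alpha1_exist mu muc gamma /\
               (const_on01 a (alpha1m mu muc gamma + k%:~R * (2 * pi)) \/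
                const_on01 a (alpha1p mu muc gamma + k%:~R * (2 * pi))))),
         (muc_crit mu gamma < muc ->
            is_local_minimizer mu muc gamma (ubar gamma)
              (cst (alpha2 gamma))) &
         (alpha1_exist mu muc gamma -> muc < mu -> muc <= muc_crit mu gamma ->
            (alpha1m mu muc gamma <> alpha2 gamma ->
               is_local_minimizer mu muc gamma (ubar gamma)
                 (cst (alpha1m mu muc gamma))) /\
            (alpha1p mu muc gamma <> alpha2 gamma ->
               is_local_minimizer mu muc gamma (ubar gamma)
                 (cst (alpha1p mu muc gamma))))]).
Proof.
have mm0 : 0 <= mu + muc by rewrite addr_ge0// ltW.
have EL2 : euler_lagrange mu muc (ubar gamma) (cst (alpha2 gamma)).
  by apply: euler_lagrange_cst; rewrite coproj_alpha2 mul0r.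
have ELproj alpha : (mu - muc) * proj gamma alpha = 2 * mu ->
    euler_lagrange mu muc (ubar gamma) (cst alpha).
  by move=> h; apply: euler_lagrange_cst; rewrite h subrr mulr0.
have LM2 : muc_crit mu gamma <= muc ->
    is_local_minimizer mu muc gamma (ubar gamma) (cst (alpha2 gamma)).
  move=> hc; apply: local_minimizer_of_support => p b.
  exact: density_support_alpha2.
have LM1 alpha : muc < mu -> (mu - muc) * proj gamma alpha = 2 * mu ->
    is_local_minimizer mu muc gamma (ubar gamma) (cst alpha).
  move=> hk h; apply: local_minimizer_of_support => p b.
  exact: density_support_alpha1.
split; [|split; [|split; [|split]]].
- move=> u a [|[aD]].
    exact: minimizer_monotone (@consistent_coupling_ext R).
  exact: minimizer_monotone (@dirichlet_ext R aD).
- by exists (cst (alpha2 gamma)).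
- move=> mE; split => //.
    move=> a /(euler_lagrange_const hmu)[alpha aE [[k ak]|h]].
      by exists k; rewrite -ak.
    by move: h hmu; rewrite mE subrr mul0r; lra.
  by apply: LM2; rewrite -mE /muc_crit ger_pMr// gerBl divr_ge0// sqrtr_ge0.
- move=> muc00; have am0 : alpha1m mu muc gamma = 0.
    by rewrite muc00 alpha1m_muc0.
  have k0 : mu - muc = mu by rewrite muc00 subr0.
  have P0 : (mu - muc) * proj gamma 0 = 2 * mu.
    by rewrite k0 /proj sin0 cos0; ring.
  have [p3 c3] := alpha3_proj hgamma.
  have P3 : (mu - muc) * proj gamma (alpha3 gamma) = 2 * mu.
    by rewrite k0 p3 mulrC.
  have hk : muc < mu by rewrite muc00.
  split => //.
  + by rewrite am0; split; [exact: ELproj|exact: EL2|exact: ELproj].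
  + move=> a /(euler_lagrange_const hmu)[alpha aE [[k ak]|h]].
      by exists k; apply: Or32; rewrite -ak.
    have mun0 := lt0r_neq0 hmu.
    have pE : proj gamma alpha = 2.
      by apply: (mulfI mun0); rewrite -{1}k0 h mulrC.
    have fE : fconst mu muc gamma = gamma * mu by rewrite muc00 fconst_muc0.
    have [_] := second_factor_roots h; rewrite k0 fE.
    move=> [] cE.
      have [||k ak] := @proj_coproj_inj R gamma alpha 0.
      * by rewrite pE /proj sin0 cos0; ring.
      * apply: (mulfI mun0); rewrite cE /coproj sin0 cos0; ring.
      by exists k; apply: Or31; rewrite am0 -ak.
    have [||k ak] := @proj_coproj_inj R gamma alpha (alpha3 gamma).
    * by rewrite pE p3.
    * apply: (mulfI mun0); rewrite cE c3; ring.
    by exists k; apply: Or33; rewrite -ak.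
  + exact: LM1.
  + exact: LM1.
- move=> muc0 mne; split => //.
  + move=> ex1; have [k0 c] := alpha1_exist_cond hmu ex1.
    have [hd _] := ex1.
    split; apply: ELproj; first exact: (alpha1m_proj hmu hgamma k0 c).1.
    exact: (alpha1p_proj k0 hd c).1.
  + move=> hd a /(euler_lagrange_const hmu)[alpha aE [[k ak]|h]].
      by exists k; left; rewrite -ak.
    have [c roots] := second_factor_roots h.
    have k0 : mu - muc != 0 by rewrite subr_eq0.
    have ex1 := alpha1_existE hmu mne hd c.
    have [pm cm] := alpha1m_proj hmu hgamma k0 c.
    have [pp cp] := alpha1p_proj k0 hd c.
    case: roots => cE.
      have [||k ak] := @proj_coproj_inj R gamma alpha (alpha1m mu muc gamma).
      * by apply: (mulfI k0); rewrite h pm.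
      * by apply: (mulfI k0); rewrite cE cm.
      by exists k; right; split => //; left; rewrite -ak.
    have [||k ak] := @proj_coproj_inj R gamma alpha (alpha1p mu muc gamma).
    * by apply: (mulfI k0); rewrite h pp.
    * by apply: (mulfI k0); rewrite cE cp.
    by exists k; right; split => //; right; rewrite -ak.
  + by move=> hc; apply: LM2; exact: ltW.
  + move=> ex1 hk _; have [k0 c] := alpha1_exist_cond hmu ex1.
    have [hd _] := ex1.
    split=> _; apply: LM1 => //; first exact: (alpha1m_proj hmu hgamma k0 c).1.
    exact: (alpha1p_proj k0 hd c).1.
Qed.
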